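(* Let $N$ be a smooth manifold, let $T>0$, and suppose $u:\mathbb{R}\to N$ is a smooth, non-constant $T$-periodic function. Then: (1) $u$ is $S^1$-quasiperiodic, and it has an $S^1$-quasiperiodic factorization $u=U\circ\phi$ with phase function $\phi:\mathbb{R}\to S^1=\mathbb{R}/\mathbb{Z}$ given by $\phi(x)=x/T \bmod 1$. (2) The factorization in (1) is universal unless there is an $S^1$-quasiperiodic factorization of $u$ whose phase function is non-injective on an interval of the form $[a,a+T)$. That is, if for every $S^1$-quasiperiodic factorization $u=U'\circ\phi'$ and every $a\in\mathbb{R}$ the map $\phi'$ is injective on $[a,a+T)$, then the factorization in (1) is a universal quasiperiodic factorization of $u$.
   Context: Manifolds are smooth manifolds without boundary. For smooth manifolds $M,N,C$, a smooth function $u:M\to N$ is called $C$-quasiperiodic if it has a factorization $u=U\circ\phi$ where $\phi:M\to C$ is a surjective submersion and $U:C\to N$. Such a factorization is called a $C$-quasiperiodic factorization, $C$ is called its phase space, and $\phi$ its phase function. A quasiperiodic factorization is a $C$-quasiperiodic factorization for some smooth manifold $C$. A $C$-quasiperiodic factorization $u=U\circ\phi$ of a smooth function $u:M\to N$ is universal if for any other quasiperiodic factorization $u=U'\circ\phi'$ with $\phi':M\to C'$ (for any smooth manifold $C'$) there exists a smooth function $c:C'\to C$ such that $c\circ\phi'=\phi$ and $U\circ c=U'$. A function $u:\mathbb{R}\to N$ is $T$-periodic if $u(x+T)=u(x)$ for all $x\in\mathbb{R}$. *)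

(* Defs.v *)
From HB Require Import structures.
From mathcomp Require Import all_boot all_order all_algebra.
From mathcomp Require Import generic_quotient.
From mathcomp Require Import all_classical all_reals all_analysis.
From mathcomp Require Import lra zify.
Set Implicit Arguments.
Unset Strict Implicit.
Unset Printing Implicit Defensive.
Import Order.TTheory GRing.Theory Num.Theory.
Import numFieldNormedType.Exports.
Local Open Scope classical_set_scope.
Local Open Scope ring_scope.

(* C^k regularity on an open set A.  Only the germs of f at the points of A
   matter.  In finite dimension this is the usual notion: f is C^(k+1) iff it is
   differentiable and all its directional derivatives are C^k. *)
Fixpoint Ck_on {R : realType} {V W : normedModType R}
    (k : nat) (A : set V) (f : V -> W) : Prop :=
  if k is k'.+1 then
    (forall x, A x -> differentiable f x) /\ (forall v, Ck_on k' A ('D_v f))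
  else forall x, A x -> {for x, continuous f}.

Definition smooth_on {R : realType} {V W : normedModType R}
    (A : set V) (f : V -> W) : Prop := forall k, Ck_on k A f.

(* chart_fun and chart_inv are total functions; their values outside chart_dom
   and chart_fun @` chart_dom are irrelevant. *)
Record chart (R : realType) (M : topologicalType) (n : nat) := Chart {
  chart_dom : set M;
  chart_fun : M -> 'rV[R]_n;
  chart_inv : 'rV[R]_n -> M;
  chart_dom_open : open chart_dom;
  chart_img_open : open (chart_fun @` chart_dom);
  chart_funK : forall x, chart_dom x -> chart_inv (chart_fun x) = x;
  chart_fun_continuous :
    forall x, chart_dom x -> {for x, continuous chart_fun};
  chart_inv_continuous :
    forall y, (chart_fun @` chart_dom) y -> {for y, continuous chart_inv} }.

(* The atlas need not be maximal; it determines the smooth structure. *)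
Record manifold (R : realType) := Manifold {
  man_space :> topologicalType;
  man_dim : nat;
  man_atlas : set (chart R man_space man_dim);
  man_hausdorff : hausdorff_space man_space;
  man_second_countable : @second_countable man_space;
  man_cover : forall x : man_space, exists2 c, man_atlas c & chart_dom c x;
  man_compatible : forall c d, man_atlas c -> man_atlas d ->
    smooth_on (chart_fun c @` (chart_dom c `&` chart_dom d))
              (chart_fun d \o chart_inv c) }.

Section maps.
Context {R : realType}.
Implicit Types M N C : manifold R.

Definition smooth M N (f : M -> N) : Prop :=
  continuous f /\
  forall c d, man_atlas c -> man_atlas d ->
    smooth_on (chart_fun c @` (chart_dom c `&` f @^-1` chart_dom d))
              (chart_fun d \o f \o chart_inv c).

Definition submersion M N (f : M -> N) : Prop :=
  smooth f /\
  forall c d, man_atlas c -> man_atlas d ->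
  forall x, chart_dom c x -> chart_dom d (f x) ->
  forall w, exists v,
    'd (chart_fun d \o f \o chart_inv c) (chart_fun c x) v = w.

Definition qp_factorization M N C (u : M -> N) (phi : M -> C) (U : C -> N) :
    Prop :=
  [/\ submersion phi, (forall y, exists x, phi x = y), smooth U
    & forall x, u x = U (phi x)].

Definition quasiperiodic M N C (u : M -> N) : Prop :=
  exists (phi : M -> C) (U : C -> N), qp_factorization u phi U.

Definition universal_qp_factorization M N C
    (u : M -> N) (phi : M -> C) (U : C -> N) : Prop :=
  qp_factorization u phi U /\
  forall (C' : manifold R) (phi' : M -> C') (U' : C' -> N),
    qp_factorization u phi' U' ->
    exists c : C' -> C, [/\ smooth c, (forall x, c (phi' x) = phi x)
      & forall y, U (c y) = U' y].

End maps.

Arguments quasiperiodic {R M N} C u.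

Section translations.
Context {R : realType} {V : normedModType R}.

Lemma near_eq_diff (W : normedModType R) (f g : V -> W) (x : V) :
  (\forall y \near x, f y = g y) -> differentiable f x ->
  differentiable g x /\ 'd g x = 'd f x :> (V -> W).
Proof.
move=> fgx df; have fgE := nbhs_singleton fgx.
have H : g \o shift x = cst (g x) + ('d f x : V -> W) +o_ 0 id.
  apply/eqaddoP => e e0.
  have /eqaddoP/(_ e e0) fo := diff_locally df.
  move: fgx; rewrite (near_shift 0) subr0 => fgx.
  apply: filterS2 fgx fo => h /= fgh.
  by rewrite !fctE /= fgh fgE.
have dE : 'd g x = 'd f x :> (V -> W) by apply: diff_unique H; exact: diff_continuous.
by split=> //; apply/diff_locallyP; rewrite dE; split=> //; exact: diff_continuous.
Qed.

Lemma Ck_on_cst (W : normedModType R) k (A : set V) (f : V -> W) (w : W) :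
  open A -> (forall x, A x -> f x = w) -> Ck_on k A f.
Proof.
move=> oA; elim: k f w => [|k IH] f w fE /=.
  move=> x Ax; apply: differentiable_continuous.
  have nA : \forall y \near x, cst w y = f y.
    by apply: filterS (open_nbhs_nbhs (conj oA Ax)) => y /fE ->.
  by have [] := near_eq_diff nA (differentiable_cst w x).
have nA x : A x -> \forall y \near x, cst w y = f y.
  by move=> Ax; apply: filterS (open_nbhs_nbhs (conj oA Ax)) => y /fE ->.
split=> [x /nA Ax|v]; first by have [] := near_eq_diff Ax (differentiable_cst w x).
apply: (IH _ 0) => x /nA Ax; have [df dE] := near_eq_diff Ax (differentiable_cst w x).
by rewrite deriveE// dE diff_cst.
Qed.

Lemma near_shift_diff (f : V -> V) (x w : V) :
  (\forall y \near x, f y = y + w) ->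
  differentiable f x /\ 'd f x = idfun :> (V -> V).
Proof.
move=> fE; pose g : V -> V := id + cst w.
have dg : is_diff x g (id + 0) by exact: is_diffD.
have [|df ->] := @near_eq_diff _ g f x _ ex_diff.
  by apply: filterS fE => y ->.
by split=> //; rewrite diff_val addr0.
Qed.

Lemma smooth_on_near_shift (A : set V) (f : V -> V) :
  open A -> (forall x, A x -> exists w, \forall y \near x, f y = y + w) ->
  smooth_on A f.
Proof.
move=> oA fE [|k] /=.
  move=> x /fE[w /near_shift_diff[df _]].
  exact: differentiable_continuous.
split=> [x /fE[w /near_shift_diff[]]//|v].
apply: (@Ck_on_cst _ _ _ _ v) => // x /fE[w /near_shift_diff[df dE]].
by rewrite deriveE// dE.
Qed.

End translations.

Section real_line.
Variable R : realType.

Let fwd (x : R) : 'rV[R]_1 := const_mx x.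
Let bwd (v : 'rV[R]_1) : R := v 0 0.

Lemma const_mx_continuous : continuous fwd.
Proof.
move=> x A /nbhs_ballP[e e0 eA]; apply/nbhs_ballP; exists e => // y xy.
by apply: eA; split=> // i j; rewrite !mxE.
Qed.

Lemma rV1_coordK (v : 'rV[R]_1) : const_mx (v 0 0) = v.
Proof. by apply/rowP => i; rewrite mxE (ord1 i). Qed.

Lemma const_mx_image (A : set R) : fwd @` A = bwd @^-1` A.
Proof.
apply/seteqP; split=> [_ [x Ax <-]|v Av]; first by rewrite /bwd /= mxE.
by exists (v 0 0) => //; exact: rV1_coordK.
Qed.

Lemma const_mx_open (A : set R) : open A -> open (fwd @` A).
Proof.
move=> oA; rewrite const_mx_image; apply: open_comp => // v _.
exact: coord_continuous.
Qed.

Lemma real_second_countable : @second_countable R.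
Proof.
exists ((fun pq : rat * rat => `]ratr pq.1, ratr pq.2[%classic) @` setT).
  by apply: card_le_trans (card_image_le _ _) _; exact: countableP.
split=> [_ [pq _ <-]|x A /nbhs_ballP[e /= e0 eA]].
  exact: interval_open.
have [p] : exists q : rat, ratr q \in `]x - e, x[ by apply: rat_in_itvoo; rewrite ltrBlDr ltrDl.
rewrite in_itv/= => /andP[xp px].
have [q] : exists q : rat, ratr q \in `]x, x + e[ by apply: rat_in_itvoo; rewrite ltrDl.
rewrite in_itv/= => /andP[xq qx].
exists `]ratr p, ratr q[%classic.
  by split; [exists (p, q)|rewrite /= in_itv/= px xq].
move=> y /=; rewrite in_itv/= => /andP[py yq]; apply: eA.
rewrite /ball/= ltr_distlC; apply/andP; split; lra.
Qed.

Program Definition line_chart : chart R R 1 := {|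
  chart_dom := setT; chart_fun := fwd; chart_inv := bwd |}.
Next Obligation. exact: openT. Qed.
Next Obligation. exact/const_mx_open/openT. Qed.
Next Obligation. by move=> x _; rewrite /bwd mxE. Qed.
Next Obligation. by move=> x _; exact: const_mx_continuous. Qed.
Next Obligation. by move=> x _; exact: coord_continuous. Qed.

Program Definition real_line : manifold R := {|
  man_space := R; man_dim := 1; man_atlas := [set line_chart] |}.
Next Obligation. exact: norm_hausdorff. Qed.
Next Obligation. exact: real_second_countable. Qed.
Next Obligation. by move=> x; exists line_chart. Qed.
Next Obligation.
move=> _ _ -> ->; apply: smooth_on_near_shift.
  by apply: const_mx_open; apply: openI; exact: openT.
move=> v _; exists 0; near=> y.
by rewrite /= addr0; exact: rV1_coordK.
Unshelve. all: by end_near.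
Qed.

End real_line.

Section circle.
Local Open Scope quotient_scope.
Variable R : realType.

Definition int_congr (x y : R) : bool := (x - y) \is a Num.int.

Lemma int_lt1_eq0 (x : R) : x \is a Num.int -> `|x| < 1 -> x = 0.
Proof.
move=> /intrP[k ->]; rewrite -intr_norm -[1]/(1%:~R) ltr_int => k1.
by rewrite (_ : k = 0) //; lia.
Qed.

Lemma int_congr_refl : reflexive int_congr.
Proof. by move=> x; rewrite /int_congr subrr rpred0. Qed.

Lemma int_congr_sym : symmetric int_congr.
Proof. by move=> x y; rewrite /int_congr -opprB rpredN. Qed.

Lemma int_congr_trans : transitive int_congr.
Proof. by move=> y x z xy yz; rewrite /int_congr -(subrKA y) rpredD. Qed.

Canonical int_congr_equiv :=
  EquivRel int_congr int_congr_refl int_congr_sym int_congr_trans.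

Definition circle_space : topologicalType :=
  quotient_topology {eq_quot int_congr_equiv}.

Definition circle_pi : R -> circle_space :=
  \pi_(quotient_topology {eq_quot int_congr_equiv}).

Lemma circle_piP (x y : R) :
  circle_pi x = circle_pi y <-> (x - y) \is a Num.int.
Proof. exact: (rwP (eqmodP int_congr_equiv x y)). Qed.

Lemma circle_pi_continuous : continuous circle_pi.
Proof. exact: pi_continuous. Qed.

Lemma circle_pi_surj (p : circle_space) : exists x, circle_pi x = p.
Proof. by exists (repr p); exact: reprK. Qed.

Lemma circle_pi_open (A : set R) : open A -> open (circle_pi @` A).
Proof.
move=> oA.
have -> : open (circle_pi @` A) = open (circle_pi @^-1` (circle_pi @` A)).
  by [].
have -> : circle_pi @^-1` (circle_pi @` A) =
    \bigcup_(k in @setT int) ((fun x => x + k%:~R) @^-1` A).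
  apply/seteqP; split=> [x [y Ay /circle_piP /intrP[k yx]]|x [k _ /= Axk]].
    by exists k => //=; rewrite -yx addrC subrK.
  by exists (x + k%:~R) => //; apply/circle_piP; rewrite addrAC subrr add0r intr_int.
apply: bigcup_open => k _; apply: open_comp => // x _.
by apply: continuousD; [exact: cvg_id | exact: cvg_cst].
Qed.

Lemma circle_hausdorff : hausdorff_space circle_space.
Proof.
rewrite open_hausdorff => p q.
have [x <-] := circle_pi_surj p; have [y <-] := circle_pi_surj q => pq.
set m : int := Num.floor (x - y); set d : R := x - y - m%:~R.
have /andP[mx xm] := floor_itv (x - y); rewrite -/m intrD in mx xm.
have d0 : 0 < d.
  rewrite lt_neqAle /d subr_ge0 mx andbT; apply: contra pq.
  by rewrite eq_sym subr_eq0 => /eqP h; apply/eqP/circle_piP; rewrite h intr_int.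
have d1 : d < 1 by rewrite /d; lra.
pose e := Num.min d (1 - d) / 2.
have e0 : 0 < e by rewrite divr_gt0// lt_min d0 subr_gt0.
have ed : 2 * e <= d by rewrite mulrC divfK ?ge_min ?lexx.
have ed1 : 2 * e <= 1 - d by rewrite mulrC divfK ?ge_min ?lexx ?orbT.
exists (circle_pi @` ball x e, circle_pi @` ball y e).
  by rewrite !inE /=; split; [exists x|exists y] => //; exact: ballxx.
split; [exact/circle_pi_open/ball_open|exact/circle_pi_open/ball_open|].
apply/eqP/seteqP; split=> // _ [[s xs <-] [t yt /circle_piP /intrP[k ts]]].
move: xs yt; rewrite /ball /= !ltr_distlC => /andP[s1 s2] /andP[t1 t2].
have k0 : (0 < (- k - m)%:~R :> R) by rewrite intrD !intrN -ts; rewrite /d in d0 d1 ed ed1; lra.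
have k1 : ((- k - m)%:~R < 1%:~R :> R) by rewrite intrD !intrN -ts; rewrite /d in d0 d1 ed ed1; lra.
move: k0 k1; rewrite ltr0z ltr_int; clear; lia.
Qed.

Lemma circle_second_countable : @second_countable circle_space.
Proof.
have [B cB [oB nB]] := real_second_countable R.
exists ((fun A => circle_pi @` A) @` B).
  exact: card_le_trans (card_image_le _ _) cB.
split=> [_ [A BA <-]|p]; first exact/circle_pi_open/oB.
have [x <-] := circle_pi_surj p => A /circle_pi_continuous /nB[C [BC Cx] CA].
exists (circle_pi @` C); first by split; [exists C|exists x].
by move=> _ [y /CA Ay <-].
Qed.

Definition circle_rep (a : R) (p : circle_space) : R :=
  repr p - (Num.floor (repr p - a))%:~R.

Lemma circle_repK a p : circle_pi (circle_rep a p) = p.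
Proof.
rewrite -[RHS]reprK; apply/circle_piP.
by rewrite /circle_rep addrAC subrr add0r rpredN intr_int.
Qed.

Lemma circle_rep_itv a p : a <= circle_rep a p < a + 1.
Proof.
have := floor_itv (repr p - a); rewrite /circle_rep intrD => /andP[? ?].
by apply/andP; split; lra.
Qed.

Lemma circle_rep_pi a x : a <= x < a + 1 -> circle_rep a (circle_pi x) = x.
Proof.
move=> /andP[ax xa].
have /andP[ar ra] := circle_rep_itv a (circle_pi x).
have /circle_piP/intrP[k xk] := circle_repK a (circle_pi x).
have k1 : (k%:~R < 1%:~R :> R) by rewrite -xk; lra.
have k0 : (- 1 < k%:~R :> R) by rewrite -xk; lra.
have {k1} : k < 1 by rewrite ltr_int in k1.
have {k0} : - 1 < k by rewrite -(@ltr_int R).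
move=> k0 k1; have k00 : k = 0 by lia.
by apply/eqP; rewrite -subr_eq0 xk k00.
Qed.

Definition circle_arc (a : R) : set circle_space :=
  circle_pi @` `]a, a + 1[%classic.

Lemma circle_rep_continuous a p :
  circle_arc a p -> {for p, continuous (circle_rep a)}.
Proof.
move=> [x xa <-] A; rewrite circle_rep_pi; last first.
  by move: xa; rewrite /= in_itv /= => /andP[/ltW -> ->].
rewrite nbhsE => -[B [oB Bx] BA].
rewrite /nbhs/=.
have : nbhs (circle_pi x) (circle_pi @` (B `&` `]a, a + 1[%classic)).
  apply: open_nbhs_nbhs; split; last by exists x.
  by apply/circle_pi_open/openI => //; exact: interval_open.
apply: filterS => _ [y [By ya] <-] /=; rewrite circle_rep_pi; first exact: BA.
by move: ya; rewrite /= in_itv /= => /andP[/ltW -> ->].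
Qed.

Lemma circle_arc_image a (A : set R) :
  A `<=` `]a, a + 1[%classic -> circle_rep a @` (circle_pi @` A) = A.
Proof.
move=> Aa; have repA x : A x -> circle_rep a (circle_pi x) = x.
  move=> /Aa; rewrite /= in_itv /= => /andP[/ltW ax xa].
  by rewrite circle_rep_pi// ax.
apply/seteqP; split=> [_ [_ [x Ax <-] <-]|x Ax]; first by rewrite repA.
by exists (circle_pi x); [exists x|exact: repA].
Qed.

Program Definition circle_chart (a : R) : chart R circle_space 1 := {|
  chart_dom := circle_arc a;
  chart_fun := fun p => const_mx (circle_rep a p);
  chart_inv := fun v => circle_pi (v 0 0) |}.
Next Obligation. by move=> a; exact/circle_pi_open/interval_open. Qed.
Next Obligation.
move=> a; rewrite -[X in open X](image_comp (circle_rep a) (@const_mx _ _ _)).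
rewrite circle_arc_image //; exact/const_mx_open/interval_open.
Qed.
Next Obligation. by move=> a p _ /=; rewrite mxE circle_repK. Qed.
Next Obligation.
move=> a p /circle_rep_continuous ap.
by apply: continuous_comp => //; exact: const_mx_continuous.
Qed.
Next Obligation.
move=> a v _; apply: continuous_comp; first exact: coord_continuous.
exact: circle_pi_continuous.
Qed.

Program Definition circle : manifold R := {|
  man_space := circle_space; man_dim := 1; man_atlas := range circle_chart |}.
Next Obligation. exact: circle_hausdorff. Qed.
Next Obligation. exact: circle_second_countable. Qed.
Next Obligation.
move=> p; pose a := repr p - 2^-1; exists (circle_chart a); first by exists a.
exists (repr p); last exact: reprK.
by rewrite /= in_itv /=; apply/andP; split; rewrite /a; lra.
Qed.
Next Obligation.
move=> _ _ [a _ <-] [b _ <-] /=.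
have oab : open [set x | `]a, a + 1[%classic x /\ circle_arc b (circle_pi x)].
  apply: openI; first exact: interval_open.
  apply: open_comp; first by move=> x _; exact: circle_pi_continuous.
  exact/circle_pi_open/interval_open.
have -> : (fun p => const_mx (circle_rep a p)) @`
      (circle_arc a `&` circle_arc b) =
    (@const_mx R 1 1) @`
      [set x | `]a, a + 1[%classic x /\ circle_arc b (circle_pi x)].
  rewrite -[LHS](image_comp (circle_rep a) (@const_mx _ _ _)); congr (_ @` _).
  rewrite -[RHS](@circle_arc_image a); last by move=> x [].
  congr (_ @` _); apply/seteqP; split=> [p [[x xa <-] bp]|p [x [xa bx] <-]].
    by exists x.
  by split=> //; exists x.
apply: smooth_on_near_shift; first exact: const_mx_open.
move=> _ [x [xa bx] <-].
pose w := circle_rep b (circle_pi x) - x; exists (const_mx w).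
have cont : {for x, continuous (fun y => circle_rep b (circle_pi y) - y - w)}.
  apply: continuousB; last exact: cvg_cst.
  apply: continuousB; last exact: cvg_id.
  apply: continuous_comp; first exact: circle_pi_continuous.
  exact: circle_rep_continuous.
have rep_int z : circle_rep b (circle_pi z) - z \is a Num.int.
  by apply/circle_piP; exact: circle_repK.
have nx : \forall y \near x, circle_rep b (circle_pi y) = y + w.
  have n0 : nbhs (circle_rep b (circle_pi x) - x - w) (ball (0 : R) 1).
    by rewrite /w subrr; exact: nbhsx_ballx.
  have n1 : \forall y \near x,
      ball (0 : R) 1 (circle_rep b (circle_pi y) - y - w) := cont _ n0.
  apply: filterS n1 => y /=; rewrite /ball /= sub0r normrN => yw.
  apply/eqP; rewrite -subr_eq0 opprD addrA; apply/eqP/int_lt1_eq0 => //.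
  exact: rpredB (rep_int y) (rep_int x).
have n0 : nbhs ((const_mx x : 'rV[R]_1) 0 0)
    [set y | circle_rep b (circle_pi y) = y + w] by rewrite mxE.
have n1 : nbhs (const_mx x : 'rV[R]_1)
    [set v : 'rV[R]_1 | circle_rep b (circle_pi (v 0 0)) = v 0 0 + w].
  exact: (@coord_continuous R 1 1 0 0 _ _ n0).
apply: filterS n1 => v /= ->.
by apply/rowP => i; rewrite !mxE (ord1 i).
Qed.

End circle.

(* Main.v *)
Require Import Defs.
From HB Require Import structures.
From mathcomp Require Import all_boot all_order all_algebra.
From mathcomp Require Import all_classical all_reals all_analysis.
From mathcomp Require Import ring lra zify.
Import Order.TTheory GRing.Theory Num.Theory.
Import numFieldNormedType.Exports.
Local Open Scope classical_set_scope.
Local Open Scope ring_scope.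

(** Write R for the real line and S for the circle R/Z.

    The factorization: u and x |-> x/T mod 1 have compatible fibres, and any
    smooth map that is constant on the fibres of a surjective submersion from R
    onto a curve descends to a smooth map (smooth_descent), because the
    submersion has smooth local sections (local_section).  This single descent
    lemma also produces the map c required by universality.  So universality of
    phi amounts to one claim: if P : R -> C is the phase function of any
    quasiperiodic factorization of u, then P x = P y forces x - y to lie in TZ
    (fibre_sub_period).  The dimension of C is at most 1 since P is a submersion
    from R, and it is not 0 since then P, hence u, would be constant near 0.

    Everything rests on one use of the injectivity hypothesis
    (invariant_map_ge_shift): a smooth increasing k : R -> R with bounded
    displacement, x < k x and u o k = u satisfies x + T <= k x.  Indeed k has
    an Abel function, a diffeomorphism psi of R with psi o k = psi + 1
    (abel_function).  Then psi mod 1 is a phase function of u onto S, and it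
    identifies x with k x, which is not allowed inside [x, x + T).  Two
    consequences follow.

    - u is not constant on any interval (locally_nonconstant): otherwise let k
      be the translation by T with a small bump subtracted inside the interval.

    - Suppose P x0 = P y0 with y0 - x0 strictly between mT and (m+1)T.  Near
      each of its points the relation P x = P (z + mT) is the graph of a local
      diffeomorphism z of x, since P is a local diffeomorphism; such a graph is
      increasing (sheet_increasing), for otherwise moving along it would bring x
      and z + mT together, at a point where P is locally injective.  On the
      strip x < z < x + T this relation is also closed (strip_match_closed):
      near a limit point on the boundary of the strip the graph would be a local
      diffeomorphism that fixes a point after a translation by a multiple of T
      and preserves u, and since u is not constant on intervals it can only be
      that translation itself (translation_sheet).  Hence the set of x having a
      partner z in the strip is open, closed and nonempty, and the least partner
      k x is a smooth increasing function of x with x < k x < x + T and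
      u o k = u, which contradicts invariant_map_ge_shift (strip_match_false).
      So y0 - x0 lies in TZ. *)

Set Implicit Arguments.
Unset Strict Implicit.
Unset Printing Implicit Defensive.

(** * Calculus of smooth maps between normed spaces *)

Section Ck_calculus.
Context {R : realType}.
Implicit Types V W Z : normedModType R.

(** Being C^k on a set only concerns germs at its points, so it can be checked on
    any covering of A. *)
Lemma Ck_on_local V W k (A : set V) (f : V -> W) :
  (forall x, A x -> exists2 B : set V, B x & Ck_on k B f) -> Ck_on k A f.
Proof.
elim: k f => [|k IH] f fP /=; first by move=> x /fP[B Bx fB]; exact: fB.
split=> [x /fP[B Bx [df _]]|v]; first exact: df.
by apply: IH => x /fP[B Bx [_ Df]]; exists B => //; exact: Df.
Qed.

Lemma Ck_on_sub V W k (A B : set V) (f : V -> W) :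
  A `<=` B -> Ck_on k B f -> Ck_on k A f.
Proof. by move=> AB fB; apply: Ck_on_local => x /AB Bx; exists B. Qed.

(** The hypothesis constrains f and g on a neighbourhood of A, because the
    derivatives occurring in the definition are those of total functions. *)
Lemma Ck_on_near_eq V W k (A : set V) (f g : V -> W) :
  (forall x, A x -> \forall y \near x, f y = g y) -> Ck_on k A f -> Ck_on k A g.
Proof.
elim: k f g => [|k IH] f g fg /=.
  move=> fc x Ax; have fgx := fg x Ax.
  rewrite /prop_for /continuous_at -(nbhs_singleton fgx).
  by apply: cvg_trans (fc x Ax); apply: near_eq_cvg; apply: filterS fgx.
move=> [df Df]; split=> [x Ax|v].
  by have [] := near_eq_diff (fg x Ax) (df x Ax).
apply: IH (Df v) => x Ax; have /near_join fgx := fg x Ax.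
by apply: filterS fgx => y; exact: near_eq_derive.
Qed.

Lemma Ck_onW V W k (A : set V) (f : V -> W) : Ck_on k.+1 A f -> Ck_on k A f.
Proof.
elim: k f => [|k IH] f /=.
  by move=> [df _] x /df; exact: differentiable_continuous.
by move=> [df Df]; split=> // v; exact: IH.
Qed.


Lemma Ck_on_eq V W k (A : set V) (f g : V -> W) :
  open A -> (forall x, A x -> f x = g x) -> Ck_on k A f -> Ck_on k A g.
Proof.
move=> oA fg; apply: Ck_on_near_eq => x Ax.
by apply: filterS (open_nbhs_nbhs (conj oA Ax)).
Qed.

Lemma Ck_onD V W k (A : set V) (f g : V -> W) :
  open A -> Ck_on k A f -> Ck_on k A g -> Ck_on k A (f + g).
Proof.
move=> oA; elim: k f g => [|k IH] f g /=.
  by move=> fc gc x Ax; apply: continuousD; [exact: fc|exact: gc].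
move=> [df Df] [dg Dg]; split=> [x Ax|v].
  by apply: differentiableD; [exact: df|exact: dg].
apply: Ck_on_eq (IH _ _ (Df v) (Dg v)) => // x Ax.
by rewrite deriveD//; apply: diff_derivable; [exact: df|exact: dg].
Qed.

(** Registered so that the differential of a continuous bilinear map gives the
    product rule for a scalar function times a vector-valued one. *)
Lemma scaler_is_bilinear W :
  bilinear_for
    (GRing.Scale.Law.clone _ _ *:%R _) (GRing.Scale.Law.clone _ _ *:%R _)
    (@GRing.scale R W).
Proof.
split=> [u'|u] a x y /=.
- by rewrite scalerDl scalerA.
- by rewrite scalerDr !scalerA mulrC.
Qed.
HB.instance Definition _ W := bilinear_isBilinear.Build R R W W _ _
  (@GRing.scale R W) (@scaler_is_bilinear W).

Lemma diff_scaling V W (a : V -> R) (g : V -> W) (x : V) :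
  differentiable a x -> differentiable g x ->
  differentiable (fun y => a y *: g y) x /\
  'd (fun y => a y *: g y) x = (fun v => a x *: 'd g x v + 'd a x v *: g x)
    :> (V -> W).
Proof.
move=> da dg.
have sc : continuous (fun p : R * W => @GRing.scale R W p.1 p.2).
  by move=> p; exact: scale_continuous.
have dp := differentiable_pair da dg.
have ds := @differentiable_bilin _ _ _ _ (@GRing.scale R W) (a x, g x) sc.
split; first exact: differentiable_comp dp ds.
by rewrite (diff_comp dp ds) diff_bilin// diff_pair.
Qed.

Lemma Ck_on_scaling V W k (A : set V) (a : V -> R) (g : V -> W) :
  open A -> Ck_on k A a -> Ck_on k A g -> Ck_on k A (fun y => a y *: g y).
Proof.
move=> oA; elim: k a g => [|k IH] a g /=.
  by move=> ac gc x Ax; apply: continuousZ; [exact: ac|exact: gc].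
move=> [da Da] [dg Dg]; split=> [x Ax|v].
  by have [] := diff_scaling (da x Ax) (dg x Ax).
have aA : Ck_on k A a by apply: Ck_onW.
have gA : Ck_on k A g by apply: Ck_onW.
apply: Ck_on_eq (Ck_onD oA (IH _ _ aA (Dg v)) (IH _ _ (Da v) gA)) => // x Ax.
have [dag dE] := diff_scaling (da x Ax) (dg x Ax).
by rewrite [RHS]deriveE// dE -!deriveE//; [exact: da|exact: dg].
Qed.

(** The chain rule is a product here because the middle space is R: only the
    derivative of g in direction 1 occurs, and no basis has to be chosen. *)
Lemma Ck_on_comp V W k (A : set V) (B : set R) (f : V -> R) (g : R -> W) :
  open A -> open B -> (forall x, A x -> B (f x)) ->
  Ck_on k A f -> Ck_on k B g -> Ck_on k A (g \o f).
Proof.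
move=> oA oB AB; elim: k g => [|k IH] g /=.
  by move=> fc gc x Ax; apply: continuous_comp; [exact: fc|exact/gc/AB].
move=> [df Df] [dg Dg]; split=> [x Ax|v].
  by apply: differentiable_comp; [exact: df|exact/dg/AB].
have fA : Ck_on k A f by apply: Ck_onW.
apply: Ck_on_eq (Ck_on_scaling oA (Df v) (IH _ fA (Dg 1))) => // x Ax /=.
have dfx := df x Ax; have dgx := dg _ (AB _ Ax).
rewrite [RHS]deriveE; last exact: differentiable_comp.
rewrite diff_comp//= !deriveE// -[X in _ = 'd g _ X]mulr1.
by rewrite -[X in _ = 'd g _ X]/(_ *: _) linearZ.
Qed.

Lemma derive_linear_comp V W Z (f : V -> W) (L : {linear W -> Z}) x v :
  continuous L -> differentiable f x -> 'D_v (L \o f) x = L ('D_v f x).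
Proof.
move=> cL df; have dL y := linear_differentiable y cL.
rewrite deriveE; last exact: differentiable_comp.
by rewrite diff_comp//= diff_lin// deriveE.
Qed.

Lemma Ck_on_linear_comp V W Z k (A : set V) (f : V -> W) (L : {linear W -> Z}) :
  open A -> continuous L -> Ck_on k A f -> Ck_on k A (L \o f).
Proof.
move=> oA cL; elim: k f => [|k IH] f /=.
  by move=> fc x Ax; apply: continuous_comp; [exact: fc|exact: cL].
move=> [df Df]; have dL y := linear_differentiable y cL.
split=> [x Ax|v]; first by apply: differentiable_comp => //; exact: df.
apply: Ck_on_eq (IH _ (Df v)) => // x Ax /=; have dfx := df x Ax.
by rewrite derive_linear_comp.
Qed.

Lemma Ck_on_comp_linear V W Z k (A : set W) (f : W -> Z) (L : {linear V -> W}) :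
  open A -> continuous L -> Ck_on k A f -> Ck_on k (L @^-1` A) (f \o L).
Proof.
move=> oA cL; have oLA : open (L @^-1` A) by apply: open_comp => // x _.
elim: k f => [|k IH] f /=.
  by move=> fc x Ax; apply: continuous_comp; [exact: cL|exact: fc].
move=> [df Df]; have dL y := linear_differentiable y cL.
split=> [x Ax|v]; first by apply: differentiable_comp => //; exact: df.
apply: Ck_on_eq (IH _ (Df (L v))) => // x Ax /=; have dfx := df _ Ax.
rewrite [RHS]deriveE; last exact: differentiable_comp.
by rewrite diff_comp//= diff_lin// deriveE.
Qed.

Lemma Ck_on_linear V W k (L : {linear V -> W}) : continuous L -> Ck_on k setT L.
Proof.
move=> cL; elim: k => [|k IH] /=; first by move=> x _; exact: cL.
have dL y := linear_differentiable y cL.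
split=> // v; apply: (@Ck_on_cst _ _ _ k setT _ (L v)) => [|x _].
  exact: openT.
by rewrite deriveE// diff_lin.
Qed.

Lemma Ck_on_id V k (A : set V) : Ck_on k A (@id V).
Proof.
apply: Ck_on_sub (@subsetT _ A) _.
have -> : @id V = (idfun : {linear V -> V}) by [].
by apply: Ck_on_linear => x.
Qed.

Lemma Ck_on_const V W k (A : set V) (w : W) : Ck_on k A (cst w).
Proof.
by apply: Ck_on_sub (@subsetT _ A) _; apply: (@Ck_on_cst _ _ _ k _ _ w) => //; exact: openT.
Qed.

(** By induction on k, from the formula - f^-2 D f for the derivative. *)
Lemma Ck_on_inv V k (A : set V) (f : V -> R) :
  open A -> (forall x, A x -> f x != 0) -> Ck_on k A f ->
  Ck_on k A (fun x => (f x)^-1).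
Proof.
move=> oA f0; elim: k => [|k IH] /=.
  by move=> fc x Ax; apply: cvgV; [exact: f0|exact: fc].
move=> /[dup] /(@Ck_onW _ _ k A f)/IH fV [df Df]; split=> [x Ax|v].
  by apply: differentiableV; [exact: df|exact: f0].
have sqV := Ck_on_scaling oA fV fV.
have := Ck_on_scaling oA (@Ck_on_const _ _ k A (- 1 : R)) (Ck_on_scaling oA sqV (Df v)).
apply: Ck_on_eq => // x Ax.
rewrite [RHS]deriveV; [|exact: f0|exact/diff_derivable/df].
rewrite /= /GRing.scale/=; have := f0 x Ax; set a := f x => a0.
by field.
Qed.

End Ck_calculus.

(** * Inverse functions of one real variable *)

Section one_variable.
Context {R : realType}.
Implicit Types (f g : R -> R) (A B : set R).

Lemma near_distP (x : R) (P : R -> Prop) :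
  (\forall y \near x, P y) <-> exists2 e, 0 < e & forall y, `|y - x| < e -> P y.
Proof.
split=> [/nbhs_ballP[e /= e0 eP]|[e e0 eP]].
  by exists e => // y yx; apply: eP; rewrite /ball/= distrC.
by apply/nbhs_ballP; exists e => // y; rewrite /ball/= distrC => /eP.
Qed.

Lemma IVT_le f (a b v : R) :
  a <= b -> (forall z, a <= z <= b -> {for z, continuous f}) ->
  f a <= v <= f b -> exists2 c, a <= c <= b & f c = v.
Proof.
move=> ab fc /andP[av vb].
have [||c cab fcv] := @IVT R f a b v ab.
- apply: continuous_in_subspaceT => z; rewrite inE /= in_itv /=; exact: fc.
- by rewrite ge_min av le_max vb orbT.
by exists c => //; move: cab; rewrite in_itv.
Qed.

Lemma derive_gt0_lt f (a b : R) : a < b ->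
  (forall z, a <= z <= b -> differentiable f z) ->
  (forall z, a <= z <= b -> 0 < 'D_1 f z) -> f a < f b.
Proof.
move=> ab df f0.
have oc z : z \in `]a, b[ -> a <= z <= b.
  by rewrite in_itv /= => /andP[/ltW -> /ltW ->].
apply: (@gtr0_derive1_lt_cc _ f a b) => //.
- by move=> z /oc/df; exact: diff_derivable.
- by move=> z /oc/f0; rewrite derive1E.
- apply: continuous_in_subspaceT => z; rewrite inE /= in_itv /= => /df.
  exact: differentiable_continuous.
- by rewrite in_itv /= lexx ltW.
- by rewrite in_itv /= lexx ltW.
Qed.

(** The derivative of g is 1 / (f' o g), so g is C^(k+1) as soon as it is C^k. *)
Lemma smooth_on_inverse A B f g : open A -> open B ->
  (forall x, A x -> B (f x) /\ g (f x) = x) ->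
  (forall y, B y -> A (g y) /\ f (g y) = y) ->
  smooth_on A f -> (forall x, A x -> 'D_1 f x != 0) -> smooth_on B g.
Proof.
move=> oA oB fAB gBA sf f'0.
have [df _] := sf 1%N.
have dg y : B y -> is_derive y 1 g ('D_1 f (g y))^-1.
  move=> By; have [Agy fgy] := gBA y By; rewrite -[X in is_derive X]fgy.
  have nA := open_nbhs_nbhs (conj oA Agy).
  apply: is_derive_inverse => //; last exact: f'0.
  - by apply: filterS nA => t /fAB[].
  - by apply: filterS nA => t /df/differentiable_continuous.
  - by apply/derivableP/diff_derivable/df.
have diffg y : B y -> differentiable g y.
  by move=> /dg[/derivable1_diffP].
elim=> [|k IH] /=; first by move=> y /diffg/differentiable_continuous.
split=> // v; have [_ /(_ 1) Df] := sf k.+1.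
have f'g := Ck_on_comp oB oA (fun y By => (gBA y By).1) IH Df.
have f'g0 y : B y -> ('D_1 f \o g) y != 0 by move=> /gBA[/f'0].
have := Ck_on_scaling oB (@Ck_on_const _ _ _ k B v) (Ck_on_inv oB f'g0 f'g).
apply: Ck_on_eq => // y By /=; have [_ <-] := dg y By.
rewrite !deriveE; [|exact: diffg..].
by rewrite -[X in _ = 'd g y X]mulr1 -[X in _ = 'd g y X]/(_ *: _) linearZ.
Qed.

(** A and B are mapped onto each other by f and g; the nonvanishing derivative
    of f is what makes g smooth. *)
Definition local_diffeo f g A B := [/\ open A, open B,
  (forall x, A x -> B (f x) /\ g (f x) = x),
  (forall y, B y -> A (g y) /\ f (g y) = y) &
  (forall x, A x -> 'D_1 f x != 0)].

(** f is increasing on a small segment [a, b] around x, and the intermediate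
    value theorem provides the inverse on the open interval ]f a, f b[. *)
Lemma exists_local_diffeo_gt0 f A (x : R) : open A -> A x ->
  smooth_on A f -> 0 < 'D_1 f x ->
  exists (A' B : set R) g, [/\ local_diffeo f g A' B, A' x & A' `<=` A].
Proof.
move=> oA Ax sf f'x.
have [_ /(_ 1) f'c] := sf 1%N.
have [df _] := sf 1%N.
have f'pos : \forall y \near x, 0 < 'D_1 f y.
  exact: (cvgr_gt _ (f'c x Ax)) f'x.
have /near_distP[e e0 eP] : \forall y \near x, A y /\ 0 < 'D_1 f y.
  by apply: filterS2 (open_nbhs_nbhs (conj oA Ax)) f'pos.
set a := x - e / 2; set b := x + e / 2.
have ab t : a <= t <= b -> A t /\ 0 < 'D_1 f t.
  by move=> /andP[at_ tb]; apply: eP; rewrite ltr_distl /a /b in at_ tb *; lra.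
have fm s t : a <= s -> s < t -> t <= b -> f s < f t.
  move=> as_ st tb.
  have stab z : s <= z <= t -> A z /\ 0 < 'D_1 f z.
    by move=> /andP[sz zt]; apply: ab; apply/andP; split; lra.
  by apply: derive_gt0_lt => // z /stab[]// /df.
have lta : a < b by rewrite /a /b; lra.
have /choice[g gP] : forall y, exists t, f a < y < f b -> a < t < b /\ f t = y.
  move=> y; have [/andP[ay yb]|nay] := boolP (f a < y < f b); last by exists 0.
  have [||t /andP[] at_ tb fty] := @IVT_le f a b y (ltW lta).
  - by move=> z /ab[/df/differentiable_continuous].
  - by rewrite !ltW.
  exists t => _; split=> //; apply/andP; split; rewrite lt_neqAle.
    by rewrite at_ andbT; apply/eqP => E; move: ay; rewrite E fty ltxx.
  by rewrite tb andbT; apply/eqP => E; move: yb; rewrite -E fty ltxx.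
exists `]a, b[%classic, `]f a, f b[%classic, g; split.
- split; [exact: interval_open|exact: interval_open| | |].
  + move=> t /=; rewrite !in_itv /= => /andP[at_ tb].
    have fab : f a < f t < f b by rewrite !fm// ltW.
    split=> //; have [/andP[ag gb] fg] := gP _ fab.
    case: (ltgtP (g (f t)) t) => // tg; exfalso.
      by have := fm _ _ (ltW ag) tg (ltW tb); rewrite fg ltxx.
    by have := fm _ _ (ltW at_) tg (ltW gb); rewrite fg ltxx.
  + by move=> y /=; rewrite !in_itv /= => /gP.
  + move=> t /=; rewrite in_itv /= => /andP[at_ tb].
    by rewrite gt_eqF//; have [] := ab t _; rewrite ?ltW.
- by rewrite /= in_itv /= /a /b; apply/andP; split; lra.
- by move=> t /=; rewrite in_itv /= => /andP[at_ tb]; have [] := ab t _; rewrite ?ltW.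
Qed.

Lemma exists_local_diffeo f A (x : R) : open A -> A x ->
  smooth_on A f -> 'D_1 f x != 0 ->
  exists (A' B : set R) g, [/\ local_diffeo f g A' B, A' x & A' `<=` A].
Proof.
move=> oA Ax sf; rewrite neq_lt => /orP[f'x|f'x]; last first.
  exact: exists_local_diffeo_gt0 sf _.
have sNf : smooth_on A (- f).
  move=> k; have := Ck_on_scaling oA (@Ck_on_const _ _ _ k A (- 1 : R)) (sf k).
  by apply: Ck_on_eq => // t _; rewrite scaleN1r.
have [df _] := sf 1%N.
have DN t : A t -> 'D_1 (- f) t = - 'D_1 f t.
  by move=> At; rewrite deriveN//; exact/diff_derivable/df.
have [|A' [B [g [[oA' oB fB gA f'0] A'x A'A]]]] :=
  exists_local_diffeo_gt0 oA Ax sNf _; first by rewrite DN// oppr_gt0.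
exists A', (-%R @^-1` B), (g \o -%R); split=> //; split=> //.
- by apply: open_comp => // t _; exact: opp_continuous.
- by move=> t /= /gA[Agt /oppr_inj].
- by move=> t /[dup] /A'A At /f'0; rewrite DN// oppr_eq0.
Qed.

End one_variable.

(** * Flat functions, humps and steps *)

Section flat_functions.
Context {R : realType}.
Implicit Types (n : nat) (x : R).

(** The functions x^-n exp(-1/x), extended by 0 to x <= 0: up to linear
    combinations, this family is closed under differentiation. *)
Definition flat n x : R := if 0 < x then x^-1 ^+ n * expR (- x^-1) else 0.

Lemma flat_ge0 n x : 0 <= flat n x.
Proof.
by rewrite /flat; case: ifP => // x0; rewrite mulr_ge0 ?expR_ge0// exprn_ge0// invr_ge0 ltW.
Qed.

Lemma flat_gt0 n x : 0 < x -> 0 < flat n x.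
Proof. by move=> x0; rewrite /flat x0 mulr_gt0 ?expR_gt0// exprn_gt0// invr_gt0. Qed.

Lemma flat_eq0 n x : x <= 0 -> flat n x = 0.
Proof. by rewrite leNgt /flat => /negbTE ->. Qed.

Lemma flatS n x : flat n x = flat n.+1 x * x.
Proof.
rewrite /flat; case: ifP => x0; last by rewrite mul0r.
by rewrite exprS mulrAC (mulrAC _ _ x) mulVf ?gt_eqF// mul1r.
Qed.

(** With y = 1/x this is y^(n+1) / (n+1)! <= exp y. *)
Lemma flat_le_fact n x : flat n.+1 x <= n.+1`!%:R.
Proof.
rewrite /flat; case: ifP => // x0; rewrite expRN ler_pdivrMr ?expR_gt0//.
have /(expR_ge1Dxn n) : 0 <= x^-1 by rewrite invr_ge0 ltW.
have f0 : 0 < n.+1`!%:R :> R by rewrite ltr0n fact_gt0.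
move=> h; rewrite mulrC -ler_pdivrMr//; apply: le_trans h.
by rewrite lerDr.
Qed.

Lemma flat0_le1 x : flat 0 x <= 1.
Proof.
rewrite /flat; case: ifP => // x0; rewrite expr0 mul1r expRN invf_le1 ?expR_gt0//.
by rewrite ltW// expR_gt1 invr_gt0.
Qed.

(** By flatS, flat n x is flat n.+1 x times x, and the first factor is bounded. *)
Lemma flat_continuous0 n : {for 0, continuous (flat n)}.
Proof.
rewrite /prop_for /continuous_at flat_eq0//; apply/cvgrPdist_lt => e e0.
set M : R := n.+1`!%:R; have M0 : 0 < M by rewrite ltr0n fact_gt0.
apply/near_distP; exists (e / M); first exact: divr_gt0.
move=> y; rewrite subr0 sub0r normrN => yM.
rewrite ger0_norm ?flat_ge0// flatS.
have [y0|y0] := leP y 0; first by rewrite flat_eq0// mul0r.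
rewrite gtr0_norm// in yM.
have := ler_wpM2r (ltW y0) (flat_le_fact n y); rewrite -/M => /le_lt_trans; apply.
by rewrite mulrC -ltr_pdivlMr.
Qed.

Lemma is_derive_flat n x :
  is_derive x 1 (flat n) (flat n.+2 x - n%:R * flat n.+1 x).
Proof.
have [x0|x0|->] := ltgtP x 0.
- rewrite !(flat_eq0 _ (ltW x0)) mulr0 subr0.
  apply: (@near_eq_is_derive _ _ _ (cst 0)).
  by apply: filterS (lt_nbhsl x0) => y /ltW y0; rewrite flat_eq0.
- apply: (@near_eq_is_derive _ _ _ (fun y : R => y^-1 ^+ n * expR (- y^-1))).
    by apply: filterS (lt_nbhsr x0) => y y0; rewrite /flat y0.
  have xN0 : x != 0 by rewrite gt_eqF.
  have dV : is_derive x 1 (fun y : R => y^-1) (- x ^- 2 *: (1 : R)).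
    exact: is_deriveV.
  have dN : is_derive x 1 (fun y : R => - y^-1) (- (- x ^- 2 *: (1 : R))).
    exact: is_deriveN.
  have dX := is_deriveX n dV.
  have dE := is_derive1_comp (is_derive_expR _) dN.
  have -> : (fun y : R => y^-1 ^+ n * expR (- y^-1)) =
      [eta GRing.inv] ^+ n * (expR \o (fun y : R => - y^-1)).
    by apply/funext => y; rewrite fctE exprfctE.
  apply: (is_derive_eq (is_deriveM dX dE)).
  rewrite exprfctE.
  rewrite /flat x0 /GRing.scale /= !mulr1 -!exprVn.
  case: n {dX} => [|n]; first by rewrite !expr0 mulr0n; ring.
  rewrite -mulr_natr /= !exprS.
  set a := x^-1; set z := expR _.
  by ring.
(* By flatS the difference quotient at 0 is flat n.+1, which is continuous. *)
- rewrite !(flat_eq0 _ (lexx 0)) mulr0 subr0; apply/is_derive1_caratheodory.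
  exists (flat n.+1); split; [|exact: flat_continuous0|exact: flat_eq0].
  by move=> z; rewrite (flat_eq0 _ (lexx 0)) !subr0 flatS.
Qed.

Lemma Ck_on_derivable (k : nat) (f f' : R -> R) :
  (forall x, is_derive x 1 f (f' x)) -> Ck_on k setT f' -> Ck_on k.+1 setT f.
Proof.
move=> df f'k; have diff_f x : differentiable f x.
  by case: (df x) => /derivable1_diffP.
split=> // v.
have := Ck_on_scaling openT (@Ck_on_const _ _ _ k _ v) f'k.
apply: Ck_on_eq openT _ => x _ /=; have [_ <-] := df x.
rewrite !deriveE//.
by rewrite -[X in _ = 'd f x X]mulr1 -[X in _ = 'd f x X]/(_ *: _) linearZ.
Qed.

Lemma flat_smooth n : smooth_on setT (flat n).
Proof.
move=> k; elim: k n => [|k IH] n.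
  by move=> x _; have [/derivable1_diffP/differentiable_continuous] := is_derive_flat n x.
apply: Ck_on_derivable (is_derive_flat n) _.
have := Ck_on_scaling openT (@Ck_on_const _ _ _ k _ (- n%:R : R)) (IH n.+1).
move=> /(Ck_onD openT (IH n.+2)); apply: Ck_on_eq openT _ => x _ /=.
by rewrite !fctE /GRing.scale /= mulNr.
Qed.

End flat_functions.

Section smooth_real_functions.
Context {R : realType}.
Implicit Types (f g : R -> R).

Lemma smoothR_comp (W : normedModType R) f (g : R -> W) :
  smooth_on setT f -> smooth_on setT g -> smooth_on setT (g \o f).
Proof.
by move=> sf sg k; apply: Ck_on_comp (sf k) (sg k) => //; exact: openT.
Qed.

Lemma smoothR_add f g :
  smooth_on setT f -> smooth_on setT g -> smooth_on setT (f + g).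
Proof. by move=> sf sg k; apply: Ck_onD (sf k) (sg k); exact: openT. Qed.

Lemma smoothR_mul f g :
  smooth_on setT f -> smooth_on setT g -> smooth_on setT (f * g).
Proof. by move=> sf sg k; apply: Ck_on_scaling (sf k) (sg k); exact: openT. Qed.

Lemma smoothR_cst (c : R) : smooth_on setT (cst c : R -> R).
Proof. by move=> k; exact: Ck_on_const. Qed.

Lemma smoothR_affine (a b : R) : smooth_on setT (fun x : R => a * x + b).
Proof.
have := smoothR_add (smoothR_mul (smoothR_cst a) (fun k => @Ck_on_id _ _ k setT))
  (smoothR_cst b).
by [].
Qed.

Lemma is_derive_affine (a b x : R) : is_derive x 1 (fun x : R => a * x + b) a.
Proof.
have d := is_deriveD (is_deriveZ a (is_derive_id x (1 : R))) (is_derive_cst b x 1).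
have aE : a *: 1 + 0 = a by rewrite addr0 /GRing.scale /= mulr1.
exact: is_derive_eq d aE.
Qed.

Lemma smoothR_is_derive f (x : R) : smooth_on setT f -> is_derive x 1 f ('D_1 f x).
Proof. by move=> /(_ 1%N)[df _]; exact/derivableP/diff_derivable/df. Qed.

Lemma smoothR_continuous f : smooth_on setT f -> continuous f.
Proof. by move=> /(_ 0%N) fc x; exact: fc. Qed.

Lemma is_derive_flat0 (x : R) : is_derive x 1 (flat 0) (flat 2 x).
Proof. by apply: is_derive_eq (is_derive_flat 0 x) _; rewrite mul0r subr0. Qed.

Lemma is_derive_flat0_affine (a b x : R) :
  is_derive x 1 (fun x : R => flat 0 (a * x + b)) (flat 2 (a * x + b) * a).
Proof. exact: is_derive1_comp (is_derive_flat0 _) (is_derive_affine a b x). Qed.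

Lemma flat_affine_smooth n (a b : R) :
  smooth_on setT (fun x : R => flat n (a * x + b)).
Proof. exact: smoothR_comp (smoothR_affine a b) (flat_smooth n). Qed.

(** A smooth function supported in [p, q].  The arguments of flat are written as
    affine expressions a x + b so that one derivative formula serves for hump
    and step. *)
Definition hump (p q x : R) : R := flat 0 (1 * x + - p) * flat 0 (-1 * x + q).

Lemma hump_smooth p q : smooth_on setT (hump p q).
Proof. exact: smoothR_mul (flat_affine_smooth _ _ _) (flat_affine_smooth _ _ _). Qed.

Lemma hump_ge0 p q x : 0 <= hump p q x.
Proof. by rewrite mulr_ge0// flat_ge0. Qed.

Lemma hump_le1 p q x : hump p q x <= 1.
Proof. by rewrite mulr_ile1// ?flat_ge0// flat0_le1. Qed.

Lemma hump_gt0 p q x : p < x < q -> 0 < hump p q x.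
Proof. by move=> /andP[px xq]; rewrite mulr_gt0// flat_gt0//; lra. Qed.

Lemma hump_eq0 p q x : ~~ (p < x < q) -> hump p q x = 0.
Proof.
rewrite negb_and -!leNgt /hump => /orP[xp|qx].
  by rewrite [X in X * _]flat_eq0 ?mul0r//; lra.
by rewrite [X in _ * X]flat_eq0 ?mulr0//; lra.
Qed.

Lemma hump_derive_le p q x : `|'D_1 (hump p q) x| <= 2.
Proof.
have d := is_deriveM (is_derive_flat0_affine 1 (- p) x) (is_derive_flat0_affine (-1) q x).
rewrite (derive_val (is_derive := d)) /GRing.scale /=.
set A := flat 0 _; set B := flat 2 _; set C := flat 0 _; set D := flat 2 _.
have f2 (y : R) : flat 2 y <= 2 by have := flat_le_fact 1 y.
have : 0 <= A * B <= 2.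
  by rewrite mulr_ge0 ?flat_ge0//= -[2]mul1r ler_pM ?flat_ge0 ?flat0_le1 ?f2.
have : 0 <= C * D <= 2.
  by rewrite mulr_ge0 ?flat_ge0//= -[2]mul1r ler_pM ?flat_ge0 ?flat0_le1 ?f2.
by move=> /andP[? ?] /andP[? ?]; rewrite ler_norml; apply/andP; split; lra.
Qed.

Definition step_den (l x : R) : R := flat 0 (1 * x + 0) + flat 0 (-1 * x + l).

(** The transition takes place in [0, l]. *)
Definition step (l x : R) : R := flat 0 (1 * x + 0) / step_den l x.

Section step.
Variable l : R.
Hypothesis l0 : 0 < l.

Let den_gt0 x : 0 < step_den l x.
Proof.
have [x0|x0] := leP x 0.
   by rewrite ltr_wpDl ?flat_ge0// flat_gt0//; move: l0 x0; clear; lra.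
by rewrite ltr_pwDl ?flat_ge0// flat_gt0//; lra.
Qed.

Lemma step_smooth : smooth_on setT (step l).
Proof.
move=> k; apply: (Ck_on_scaling openT); first exact: flat_affine_smooth.
apply: (Ck_on_inv openT) => [x _|]; first by rewrite gt_eqF// den_gt0.
by apply: (Ck_onD openT); exact: flat_affine_smooth.
Qed.

Lemma step_le0 x : x <= 0 -> step l x = 0.
Proof. by move=> x0; rewrite /step [X in X / _]flat_eq0 ?mul0r//; lra. Qed.

Lemma step_ge x : l <= x -> step l x = 1.
Proof.
move=> lx; have := den_gt0 x; rewrite /step /step_den (flat_eq0 0 (x := -1 * x + l)); last by lra.
by rewrite addr0 => d0; rewrite divff// gt_eqF.
Qed.

Lemma step_derive x : 'D_1 (step l) x =
  (flat 2 (1 * x + 0) * flat 0 (-1 * x + l) +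
   flat 0 (1 * x + 0) * flat 2 (-1 * x + l)) / (step_den l x) ^+ 2.
Proof.
have d1 := is_derive_flat0_affine 1 0 x; have d2 := is_derive_flat0_affine (-1) l x.
have dden : is_derive x 1 (step_den l) _ := is_deriveD d1 d2.
have denN0 : step_den l x != 0 by rewrite gt_eqF.
rewrite (derive_val (is_derive := is_deriveM d1 (is_deriveV denN0 dden))).
rewrite /GRing.scale /=; move: denN0; rewrite /step_den.
set A := flat 0 _; set B := flat 2 _; set C := flat 0 _; set D := flat 2 _ => AC0.
by field.
Qed.

Lemma step_derive_ge0 x : 0 <= 'D_1 (step l) x.
Proof. by rewrite step_derive divr_ge0// ?sqr_ge0// addr_ge0// mulr_ge0// flat_ge0. Qed.

Lemma step_derive_gt0 x : 0 < x < l -> 0 < 'D_1 (step l) x.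
Proof.
move=> /andP[x0 xl]; rewrite step_derive divr_gt0 ?exprn_gt0//.
by rewrite addr_gt0// mulr_gt0// flat_gt0//; lra.
Qed.

End step.
End smooth_real_functions.

(** * Maps from the line to a manifold, read in charts *)

Section coordinates.
Context {R : realType}.

Section coordinate_maps.
Variable n : nat.

Definition row_coord (i : 'I_n) (v : 'rV[R]_n) : R := v 0 i.
Definition const_row (x : R) : 'rV[R]_n := const_mx x.

Lemma row_coord_linear i : linear (row_coord i).
Proof. by move=> a u v; rewrite /row_coord !mxE. Qed.
HB.instance Definition _ i :=
  GRing.isLinear.Build R 'rV[R]_n R _ (row_coord i) (row_coord_linear i).

Lemma const_row_linear : linear const_row.
Proof. by move=> a u v; apply/rowP => i; rewrite !mxE. Qed.
HB.instance Definition _ :=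
  GRing.isLinear.Build R R 'rV[R]_n _ const_row const_row_linear.

Lemma row_coord_continuous i : continuous (row_coord i).
Proof. by move=> v; exact: coord_continuous. Qed.

Lemma const_row_continuous : continuous const_row.
Proof.
move=> x A /nbhs_ballP[e e0 eA]; apply/nbhs_ballP; exists e => // y xy.
by apply: eA; split=> // i j; rewrite !mxE.
Qed.

End coordinate_maps.

Variables (M : manifold R) (f : real_line R -> M).

Let rdom (d : chart R M (man_dim M)) : set R := f @^-1` chart_dom d.
Let read (d : chart R M (man_dim M)) : R -> 'rV[R]_(man_dim M) := chart_fun d \o f.

Lemma open_preimage_chart d : continuous f -> open (rdom d).
Proof. by move=> fc; apply: open_comp; [move=> x _; exact: fc|exact: chart_dom_open]. Qed.

Let coord0K : @row_coord 1 ord0 \o @const_row 1 = id.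
Proof. by apply/funext => x /=; rewrite /row_coord /const_row mxE. Qed.

(** The unique chart of the line is linear, so it can be removed: smoothness is
    that of the functions of a real variable obtained by reading f in charts. *)
Lemma smooth_realP : smooth f <-> continuous f /\
  forall d, man_atlas d -> smooth_on (rdom d) (read d).
Proof.
have lineE d : chart_fun (line_chart R) @`
    (chart_dom (line_chart R) `&` f @^-1` chart_dom d) =
    @row_coord 1 ord0 @^-1` rdom d.
  by rewrite setTI /= const_mx_image.
split=> [[fc fs]|[fc fs]]; split=> //.
- move=> d ad k; have := fs (line_chart R) d erefl ad k; rewrite lineE.
  have od : open (@row_coord 1 ord0 @^-1` rdom d).
    apply: open_comp; last exact: open_preimage_chart.
    by move=> v _; exact: row_coord_continuous.
  move=> /(Ck_on_comp_linear od (@const_row_continuous 1)) h.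
  have -> : read d = (read d \o @row_coord 1 ord0) \o @const_row 1.
    by rewrite -compA coord0K.
  have -> : rdom d = @const_row 1 @^-1` (@row_coord 1 ord0 @^-1` rdom d).
    by rewrite -comp_preimage coord0K.
  exact: h.
- move=> _ d -> ad k; rewrite lineE.
  exact: (Ck_on_comp_linear (open_preimage_chart fc)
    (@row_coord_continuous 1 ord0) (fs _ ad k)).
Qed.

(** The differential of a function of a real variable is determined by its value
    at 1, so its image is spanned by the derivative. *)
Lemma submersion_realP : submersion f <-> smooth f /\
  forall d, man_atlas d -> forall x, chart_dom d (f x) ->
  forall w, exists a : R, a *: 'D_1 (read d) x = w.
Proof.
have diffE d x v : smooth f -> man_atlas d -> chart_dom d (f x) ->
  'd (chart_fun d \o f \o chart_inv (line_chart R))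
     (chart_fun (line_chart R) x) v = row_coord ord0 v *: 'D_1 (read d) x.
  move=> /smooth_realP[fc fs] ad dfx; have [/(_ x dfx) dF _] := fs d ad 1%N.
  have dL y := linear_differentiable y (@row_coord_continuous 1 ord0).
  have E : row_coord ord0 (const_row 1 x : 'rV[R]_1) = x :=
    congr1 (fun h : R -> R => h x) coord0K.
  rewrite -[chart_fun d \o f \o _]/(read d \o @row_coord 1 ord0).
  rewrite -[chart_fun (line_chart R) x]/(const_row 1 x).
  have dF' : differentiable (read d) (row_coord ord0 (const_row 1 x : 'rV[R]_1)).
    by rewrite E.
  rewrite diff_comp//= diff_lin//; last exact: row_coord_continuous.
  rewrite E deriveE// -[X in 'd (read d) x X = _]mulr1.
  by rewrite -[X in 'd (read d) x X = _]/(_ *: _) linearZ.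
split=> [[fs sub]|[fs sub]]; split=> //.
- move=> d ad x dfx w; have [v] := sub (line_chart R) d erefl ad x I dfx w.
  by rewrite diffE// => <-; exists (row_coord ord0 v).
- move=> _ d -> ad x _ dfx w; have [a <-] := sub _ ad x dfx w.
  exists (const_row 1 a); rewrite diffE//.
  by congr (_ *: _); exact: (congr1 (fun h : R -> R => h a) coord0K).
Qed.

(** One vector cannot span two different coordinate axes. *)
Lemma submersion_dim_le1 : submersion f -> (man_dim M <= 1)%N.
Proof.
move=> /submersion_realP[fs sub]; rewrite leqNgt; apply/negP => n2.
have [d ad dfx] := man_cover (f 0).
pose i : 'I_(man_dim M) := Ordinal (ltnW n2); pose j := Ordinal n2.
set D := 'D_1 (read d) (0 : R).
have [a aE] := sub _ ad 0 dfx (delta_mx 0 i).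
have [b bE] := sub _ ad 0 dfx (delta_mx 0 j).
have := congr1 (fun v : 'rV_(man_dim M) => v 0 i) aE.
have := congr1 (fun v : 'rV_(man_dim M) => v 0 j) aE.
have := congr1 (fun v : 'rV_(man_dim M) => v 0 i) bE.
rewrite -/D !mxE !eqxx /= => b1 /eqP; rewrite mulf_eq0 => /orP[/eqP ->|/eqP Dj].
  by rewrite mul0r => /eqP; rewrite eq_sym oner_eq0.
have := congr1 (fun v : 'rV_(man_dim M) => v 0 j) bE.
by rewrite -/D !mxE !eqxx /= Dj mulr0 => /eqP; rewrite eq_sym oner_eq0.
Qed.

(** When the target has dimension 1, f read in the chart d is this real function;
    i is then the only coordinate. *)
Definition chart_reading (d : chart R M (man_dim M)) (i : 'I_(man_dim M)) : R -> R :=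
  row_coord i \o read d.

Hypothesis dim1 : man_dim M = 1%N.
Variable i0 : 'I_(man_dim M).

Lemma row_coordK (v : 'rV[R]_(man_dim M)) : const_row (man_dim M) (row_coord i0 v) = v.
Proof.
apply/rowP => i; rewrite !mxE; congr (v _ _); apply/val_inj.
by case: i0 i => [i hi] [j hj] /=; move: hi hj; rewrite dim1; lia.
Qed.

Lemma chart_reading_smooth d : submersion f -> man_atlas d ->
  smooth_on (rdom d) (chart_reading d i0).
Proof.
move=> /submersion_realP[/smooth_realP[fc fs] _] ad k.
by apply: Ck_on_linear_comp (fs _ ad k) => //; [exact: open_preimage_chart|exact: row_coord_continuous].
Qed.

Lemma chart_reading_derive_neq0 d x : submersion f -> man_atlas d ->
  chart_dom d (f x) -> 'D_1 (chart_reading d i0) x != 0.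
Proof.
move=> /submersion_realP[/smooth_realP[fc fs] sub] ad dfx.
have [/(_ x dfx) dF _] := fs d ad 1%N.
rewrite derive_linear_comp//; last exact: row_coord_continuous.
apply/eqP => D0.
have [a] := sub d ad x dfx (const_row _ 1).
rewrite -(row_coordK ('D_1 (read d) x)) D0 => /(congr1 (row_coord i0)).
by rewrite /row_coord /const_row !mxE mulr0 => /eqP; rewrite eq_sym oner_eq0.
Qed.

Lemma submersion_local_diffeo d (x : R) : submersion f -> man_atlas d ->
  chart_dom d (f x) -> exists (A B : set R) g,
  [/\ local_diffeo (chart_reading d i0) g A B, A x & A `<=` rdom d].
Proof.
move=> sub ad dfx; have [[fc _] _] := sub.
apply: (exists_local_diffeo _ dfx); first exact: open_preimage_chart.
  exact: chart_reading_smooth.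
exact: chart_reading_derive_neq0.
Qed.

End coordinates.

(** * Local sections and descent along submersions of the line *)

Section descent.
Context {R : realType}.
Variables (M : manifold R) (P : real_line R -> M).
Hypothesis subP : submersion P.
Hypothesis dim1 : man_dim M = 1%N.

Let i0 : 'I_(man_dim M) := cast_ord (esym dim1) ord0.

(** Here s is continuous on B only, and its values elsewhere are arbitrary. *)
Lemma open_preimage_within (B O : set R) (s : R -> R) : open B -> open O ->
  (forall b, B b -> {for b, continuous s}) -> open (B `&` s @^-1` O).
Proof.
move=> oB oO sc; rewrite openE => b [Bb Osb]; apply: filterI.
  exact: open_nbhs_nbhs (conj oB Bb).
by apply: (sc b Bb); exact: open_nbhs_nbhs (conj oO Osb).
Qed.

(** s is the local inverse of P read in the chart d, viewed as a function of the
    coordinate b of the chart. *)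
Lemma local_section d (x : R) : man_atlas d -> chart_dom d (P x) ->
  exists (B : set R) (s : R -> R), [/\ open B, smooth_on B s,
    (forall b, B b -> chart_reading P d i0 (s b) = b),
    (forall b, B b -> chart_inv d (const_row (man_dim M) b) = P (s b)) &
    \forall t \near x, [/\ chart_dom d (P t), B (chart_reading P d i0 t) &
      s (chart_reading P d i0 t) = t]].
Proof.
move=> ad dPx.
have [A [B [s [[oA oB fA sB f'0] Ax AP]]]] := submersion_local_diffeo dim1 i0 subP ad dPx.
exists B, s; split=> //.
- apply: (smooth_on_inverse oA oB fA sB _ f'0) => k.
  exact: Ck_on_sub AP (chart_reading_smooth i0 subP ad k).
- by move=> b /sB[].
- move=> b /sB[/AP dPs rb]; rewrite -{1}rb -[const_row _ _]/(const_row _ (row_coord i0 _)).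
  by rewrite row_coordK// chart_funK.
- apply: filterS (open_nbhs_nbhs (conj oA Ax)) => t At.
  by have [Bt st] := fA t At; split=> //; exact: AP.
Qed.

(** Set-theoretically g is f composed with any section of P.  Near P x it
    coincides with f composed with a smooth local section, hence it is smooth. *)
Lemma smooth_descent (N : manifold R) (f : real_line R -> N) :
  smooth f -> (forall p, exists x, P x = p) ->
  (forall x y, P x = P y -> f x = f y) ->
  exists g : M -> N, smooth g /\ forall x, g (P x) = f x.
Proof.
move=> /smooth_realP[fc fs] /choice[r rP] fP.
pose g p := f (r p); have gP x : g (P x) = f x by apply: fP.
exists g; split=> //; split.
  move=> p; have [x xp] : exists x, P x = p by exists (r p).
  have [d ad dp] := man_cover p; rewrite -xp in dp.
  have [B [s [oB sB rsB invB /nbhs_singleton[_ Bx sx]]]] := local_section ad dp.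
  have sc : {for chart_reading P d i0 x, continuous s} by apply: (sB 0%N).
  have rc : {for P x, continuous (row_coord i0 \o chart_fun d)}.
    by apply: continuous_comp; [exact: chart_fun_continuous|exact: row_coord_continuous].
  have nB : \forall q \near P x, chart_dom d q /\ B (row_coord i0 (chart_fun d q)).
    apply: filterI; first exact: open_nbhs_nbhs (conj (chart_dom_open d) dp).
    by apply: rc; exact: open_nbhs_nbhs.
  have gE : \forall q \near P x, f (s (row_coord i0 (chart_fun d q))) = g q.
    apply: filterS nB => q [dq Bq]; rewrite -gP -invB//.
    by rewrite row_coordK// chart_funK.
  have fsc : {for P x, continuous (f \o (s \o (row_coord i0 \o chart_fun d)))}.
    apply: continuous_comp; last exact: fc.
    by apply: continuous_comp; [exact: rc|exact: sc].
  rewrite -xp /continuous_at -(nbhs_singleton gE).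
  by apply: cvg_trans fsc; apply: near_eq_cvg; exact: filterS gE.
move=> d e ad ae k; apply: Ck_on_local => _ [p [dp ep] <-].
have [x xp] : exists x, P x = p by exists (r p).
rewrite -xp in dp ep *; rewrite /= gP in ep.
have [B [s [oB sB rsB invB /nbhs_singleton[_ Bx sx]]]] := local_section ad dp.
pose O : set R := f @^-1` chart_dom e.
have oO : open O by exact: open_preimage_chart.
have oBO : open (B `&` s @^-1` O).
  by apply: open_preimage_within => // b; exact: (sB 0%N).
exists (@row_coord R (man_dim M) i0 @^-1` (B `&` s @^-1` O)).
  by split=> //=; rewrite -[row_coord _ _]/(chart_reading P d i0 x) /O /= sx.
have := Ck_on_comp oBO oO (fun b (h : (B `&` s @^-1` O) b) => h.2)
  (Ck_on_sub (@subIsetl _ B _) (sB k)) (fs _ ae k).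
move=> /(Ck_on_comp_linear oBO (@row_coord_continuous R _ i0)).
apply: Ck_on_eq.
  by apply: open_comp oBO => v _; exact: row_coord_continuous.
by move=> v [Bv Ov] /=; rewrite -gP -invB// row_coordK.
Qed.

End descent.

(** * Phase functions onto the circle *)

Section circle_phases.
Context {R : realType}.

(** The two representatives differ by an integer, which is locally constant. *)
Lemma circle_rep_near (a x : R) : circle_arc a (circle_pi x) ->
  exists w, \forall y \near x, circle_rep a (circle_pi y) = y + w.
Proof.
move=> ax; pose w := circle_rep a (circle_pi x) - x; exists w.
have cont : {for x, continuous (fun y => circle_rep a (circle_pi y) - y - w)}.
  apply: continuousB; last exact: cvg_cst.
  apply: continuousB; last exact: cvg_id.
  apply: continuous_comp; first exact: circle_pi_continuous.
  exact: circle_rep_continuous.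
have rep_int z : circle_rep a (circle_pi z) - z \is a Num.int.
  by apply/circle_piP; exact: circle_repK.
have n0 : nbhs (circle_rep a (circle_pi x) - x - w) (ball (0 : R) 1).
  by rewrite /w subrr; exact: nbhsx_ballx.
have n1 : \forall y \near x,
    ball (0 : R) 1 (circle_rep a (circle_pi y) - y - w) := cont _ n0.
apply: filterS n1 => y /=; rewrite /ball /= sub0r normrN => yw.
apply/eqP; rewrite -subr_eq0 opprD addrA; apply/eqP/int_lt1_eq0 => //.
exact: rpredB (rep_int y) (rep_int x).
Qed.

Lemma circle_lift_submersion (psi : R -> R) :
  smooth_on setT psi -> (forall x, 'D_1 psi x != 0) ->
  submersion (@circle_pi R \o psi : real_line R -> circle R).
Proof.
move=> spsi psi'0; pose phi : real_line R -> circle R := @circle_pi R \o psi.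
have phic : continuous phi.
  move=> x; apply: continuous_comp; last exact: circle_pi_continuous.
  exact: smoothR_continuous.
have near_phi (d : chart R (circle R) 1) (x : R) : man_atlas d -> chart_dom d (phi x) ->
    exists w, \forall y \near x,
      (@const_row R 1 \o (psi + cst w)) y = (chart_fun d \o phi) y.
  move=> [a _ <-] /= /circle_rep_near[w nw]; exists w.
  have h : \forall y \near x, circle_rep a (circle_pi (psi y)) = psi y + w.
    exact: (smoothR_continuous spsi nw).
  by apply: filterS h => y yE; rewrite /phi /= yE.
have spsiw w : smooth_on setT (@const_row R 1 \o (psi + cst w)).
  move=> k; apply: (Ck_on_linear_comp openT (@const_row_continuous R 1)).
  exact: smoothR_add spsi (smoothR_cst w) k.
apply/submersion_realP; split; first (apply/smooth_realP; split=> //).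
- move=> d ad k; apply: Ck_on_local => x dphix; exists [set x] => //.
  have [w nw] := near_phi d x ad dphix.
  apply: Ck_on_near_eq (Ck_on_sub (@subsetT _ _) (spsiw w k)).
  by move=> _ ->.
- move=> d ad x dphix v; have [w nw] := near_phi d x ad dphix.
  have dw : 'D_1 (psi + cst w) x = 'D_1 psi x.
    have d1 := smoothR_is_derive x spsi.
    by rewrite (derive_val (is_derive := is_deriveD d1 (is_derive_cst w x 1))) addr0.
  have spw := smoothR_add spsi (smoothR_cst w).
  have [/(_ x I) dpw _] := spw 1%N.
  have E : 'D_1 (chart_fun d \o phi : R -> 'rV[R]_1) x = const_row 1 ('D_1 psi x).
    rewrite -(@near_eq_derive _ R _ _ _ x 1 nw) -dw.
    by apply: derive_linear_comp => //; exact: const_row_continuous.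
  exists (v 0 0 / 'D_1 psi x); rewrite [X in _ *: X]E.
  apply/rowP => i; rewrite !mxE (ord1 i).
  by rewrite -mulrA mulVf// mulr1.
Qed.

End circle_phases.

(** * Abel functions *)

Section global_inverse.
Context {R : realType}.
Variables (k : R -> R) (C : R).
Hypothesis sk : smooth_on setT k.
Hypothesis k'_gt0 : forall x, 0 < 'D_1 k x.
Hypothesis k_gt : forall x, x < k x.
Hypothesis k_le : forall x, k x <= x + C.

Lemma smoothR_derive_gt0_lt (f : R -> R) : smooth_on setT f ->
  (forall x, 0 < 'D_1 f x) -> {homo f : x y / x < y}.
Proof.
move=> sf f'0 x y xy; apply: derive_gt0_lt => // z _.
by have [/(_ z I)] := sf 1%N.
Qed.

Let k_lt : {homo k : x y / x < y}. Proof. exact: smoothR_derive_gt0_lt. Qed.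

(** The bounds on k x - x make k onto, by the intermediate value theorem. *)
Lemma smooth_inverse_ex : exists j : R -> R, [/\ smooth_on setT j, cancel k j, cancel j k
  & forall x, 0 < 'D_1 j x].
Proof.
have /choice[j jK] : forall y, exists x, k x = y.
  (* k (y - C) <= y <= k y, so y is a value of k on [y - C, y]. *)
  move=> y; have C0 : 0 < C by have := k_gt 0; have := k_le 0; lra.
  have [|||c _] := @IVT_le _ k (y - C) y y; last by exists c.
  - lra.
  - by move=> z _; exact: smoothR_continuous.
  - by apply/andP; split; [have := k_le (y - C); lra|exact/ltW/k_gt].
have kK : cancel k j.
  move=> x; case: (ltgtP (j (k x)) x) => // h; exfalso.
    by have := k_lt h; rewrite jK ltxx.
  by have := k_lt h; rewrite jK ltxx.
have sj : smooth_on setT j.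
  apply: (@smooth_on_inverse _ setT setT k) => //; [exact: openT|exact: openT|].
  by move=> x _; rewrite gt_eqF.
exists j; split=> // y.
have dk := smoothR_is_derive (j y) sk; have dj := smoothR_is_derive y sj.
have [_] := is_derive1_comp dk dj.
have -> : k \o j = id by apply/funext => z /=; exact: jK.
rewrite derive_id => E; have : 0 < 'D_1 k (j y) * 'D_1 j y by rewrite -E.
by rewrite pmulr_rgt0.
Qed.

End global_inverse.

Section abel_function.
Context {R : realType}.
Variables (k j : R -> R).
Hypothesis sk : smooth_on setT k.
Hypothesis sj : smooth_on setT j.
Hypothesis k'_gt0 : forall x, 0 < 'D_1 k x.
Hypothesis j'_gt0 : forall x, 0 < 'D_1 j x.
Hypothesis kK : cancel k j.
Hypothesis jK : cancel j k.
Hypothesis k_gt : forall x, x < k x.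

Let k_lt : {homo k : x y / x < y}. Proof. exact: smoothR_derive_gt0_lt. Qed.
Let j_lt : {homo j : x y / x < y}. Proof. exact: smoothR_derive_gt0_lt. Qed.

Lemma iter_smooth_derive_gt0 (f : R -> R) n : smooth_on setT f ->
  (forall x, 0 < 'D_1 f x) ->
  smooth_on setT (iter n f) /\ forall x, 0 < 'D_1 (iter n f) x.
Proof.
move=> sf f'0; elim: n => [|n [IH IH']] /=.
  by split=> [m|x]; [exact: Ck_on_id|rewrite derive_id].
split=> [|x]; first exact: smoothR_comp IH sf.
have [_] := is_derive1_comp (smoothR_is_derive (iter n f x) sf) (smoothR_is_derive x IH).
by move=> ->; rewrite mulr_gt0.
Qed.

Let K_lt n : {homo iter n k : x y / x < y}.
Proof. by have [? ?] := iter_smooth_derive_gt0 n sk k'_gt0; exact: smoothR_derive_gt0_lt. Qed.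
Let J_lt n : {homo iter n j : x y / x < y}.
Proof. by have [? ?] := iter_smooth_derive_gt0 n sj j'_gt0; exact: smoothR_derive_gt0_lt. Qed.

Lemma iter_ge n (x : R) : x <= iter n k x.
Proof. by elim: n => // n /le_trans; apply; exact/ltW/k_gt. Qed.

(** Otherwise the supremum s of the orbit is finite.  As j s < s, some iterate
    exceeds j s, and the next one exceeds s. *)
Lemma iter_unbounded (x c : R) : exists n0, forall n, (n0 <= n)%N -> c <= iter n k x.
Proof.
suff [n cn] : exists n, c <= iter n k x.
  by exists n => m /subnK <-; rewrite iterD; apply: le_trans cn (iter_ge _ _).
apply: contrapT => /forallNP cN.
have cub n : iter n k x < c by rewrite ltNge; apply/negP/cN.
pose S := range (fun n => iter n k x).
have supS : has_sup S.
  by split; [exists x, 0%N|exists c => _ [n _ <-]; exact/ltW].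
have jlt : j (sup S) < sup S by rewrite -{2}(jK (sup S)).
have [|_ [n _ <-] jn] := @sup_adherent _ S (sup S - j (sup S)) _ supS.
  by rewrite subr_gt0.
(* The next iterate is at most sup S, but larger than k (j (sup S)) = sup S. *)
have : k (iter n k x) <= sup S by apply: sup_ubound; [exact: supS.2|exists n.+1].
by rewrite leNgt -{1}(jK (sup S)) k_lt//; lra.
Qed.

Lemma iter_inverseK n : cancel (iter n k) (iter n j).
Proof. by elim: n => // n IH x; rewrite iterSr iterS kK IH. Qed.

Lemma iter_inverseKV n : cancel (iter n j) (iter n k).
Proof. by elim: n => // n IH x; rewrite iterSr iterS jK IH. Qed.

Lemma iter_inverse_unbounded (x c : R) :
  exists n0, forall n, (n0 <= n)%N -> iter n j x <= c.
Proof.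
have [n0 n0P] := iter_unbounded c x; exists n0 => n /n0P xn.
by rewrite -[leRHS](iter_inverseK n) (le_mono (@J_lt n)).
Qed.

Let l := k 0 + 1.
Let l_gt0 : 0 < l. Proof. by rewrite addr_gt0. Qed.

Let Psi n x := \sum_(i < n)
  (step l (iter i.+1 j x) + (step l (iter i k x) - 1)).

(** Far backward iterates of a bounded interval lie in x <= 0, where the step is
    0, and far forward iterates lie beyond l, where it is 1: only finitely many
    terms of the series contribute. *)
Lemma Psi_stable (x : R) : exists N, forall n y,
  (N <= n)%N -> `|y - x| <= 1 -> Psi n y = Psi N y.
Proof.
have [n1 n1P] := iter_unbounded (x - 1) l.
have [n2 n2P] := iter_inverse_unbounded (x + 1) 0.
exists (maxn n1 n2) => n y /subnK <-; rewrite ler_distl => /andP[xy yx].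
elim: (n - _)%N => // d IH; rewrite addSn {1}/Psi big_ord_recr /= -/(Psi _ _) IH.
set m := (d + _)%N; have [m1 m2] : (n1 <= m)%N /\ (n2 <= m.+1)%N by rewrite /m; lia.
have mk : l <= iter m k y by apply: le_trans (n1P _ m1) _; rewrite (le_mono (@K_lt m)).
have mj : iter m.+1 j y <= 0.
  by apply: le_trans _ (n2P _ m2); rewrite (le_mono (@J_lt _)).
by rewrite -iterS (step_ge l_gt0 mk) step_le0// subrr !addr0.
Qed.

(** Replacing x by k x shifts the index of both sums by one, and the sums
    telescope. *)
Lemma Psi_equivariance n x :
  Psi n (k x) - Psi n x = step l (iter n k x) - step l (iter n j x).
Proof.
elim: n => [|n IH]; first by rewrite /Psi !big_ord0 /= !subrr.
rewrite /Psi !big_ord_recr -!/(Psi _ _) -iterSr /=.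
rewrite -[j (iter n j (k x))]iterS iterSr kK; lra.
Qed.

Lemma Psi_smooth n : smooth_on setT (Psi n).
Proof.
rewrite /Psi; elim: n => [|n IH].
  by under eq_fun do rewrite big_ord0; exact: smoothR_cst.
under eq_fun do rewrite big_ord_recr.
have sK m := (iter_smooth_derive_gt0 m sk k'_gt0).1.
have sJ m := (iter_smooth_derive_gt0 m sj j'_gt0).1.
have ss := step_smooth l_gt0.
exact: smoothR_add IH (smoothR_add (smoothR_comp (sJ n.+1) ss)
  (smoothR_add (smoothR_comp (sK n) ss) (smoothR_cst (- 1)))).
Qed.

Lemma Psi_derive n x : 'D_1 (Psi n) x = \sum_(i < n)
  ('D_1 (step l) (iter i.+1 j x) * 'D_1 (iter i.+1 j) x +
   'D_1 (step l) (iter i k x) * 'D_1 (iter i k) x).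
Proof.
have sK m := (iter_smooth_derive_gt0 m sk k'_gt0).1.
have sJ m := (iter_smooth_derive_gt0 m sj j'_gt0).1.
have ss := step_smooth l_gt0.
elim: n => [|n IH].
  rewrite big_ord0 -[RHS](derive_cst (0 : R) x 1); congr ('D_1 _ x).
  by apply/funext => y; rewrite /Psi big_ord0.
have dJ := is_derive1_comp (smoothR_is_derive (iter n.+1 j x) ss) (smoothR_is_derive x (sJ n.+1)).
have dK := is_derive1_comp (smoothR_is_derive (iter n k x) ss) (smoothR_is_derive x (sK n)).
have d := is_deriveD (smoothR_is_derive x (Psi_smooth n))
  (is_deriveD dJ (is_deriveD dK (is_derive_cst (-1 : R) x 1))).
have -> : Psi n.+1 = Psi n + (step l \o iter n.+1 j + (step l \o iter n k + cst (- 1))).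
  by apply/funext => y; rewrite /Psi big_ord_recr.
by rewrite (derive_val (is_derive := d)) IH big_ord_recr addr0.
Qed.

(** Every orbit meets ]0, k 0], which is contained in ]0, l[, where the step is
    strictly increasing. *)
Lemma step_orbit (x : R) : exists i, 0 < iter i k x < l \/ 0 < iter i.+1 j x < l.
Proof.
have [x0|x0] := leP x 0.
  have ex : exists n, 0 < iter n k x.
    have [n nP] := iter_unbounded x l; exists n.
    exact: lt_le_trans l_gt0 (nP n (leqnn n)).
  case: (ex_minnP ex) => -[|n] n0 nmin; first by rewrite /= ltNge x0 in n0.
  exists n.+1; left; rewrite n0 /=.
  have : iter n k x <= 0 by rewrite leNgt; apply/negP => /nmin; rewrite ltnn.
  rewrite -(le_mono k_lt) => /le_lt_trans; apply; rewrite /l; lra.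
have [xl|lx] := ltP x l; first by exists 0%N; left; rewrite /= x0.
have ex : exists n, iter n j x < l.
  have [n nP] := iter_inverse_unbounded x 0; exists n.
  exact: le_lt_trans (nP n (leqnn n)) l_gt0.
case: (ex_minnP ex) => -[|n] nl nmin; first by rewrite /= ltNge lx in nl.
exists n; right; rewrite nl andbT.
have : l <= iter n j x by rewrite leNgt; apply/negP => /nmin; rewrite ltnn.
move=> ln; rewrite iterS -[X in X < _](kK 0); apply: j_lt.
by apply: lt_le_trans ln; rewrite /l; lra.
Qed.

Lemma Psi_derive_gt0 x : exists N, forall n, (N <= n)%N -> 0 < 'D_1 (Psi n) x.
Proof.
have [i iP] := step_orbit x; exists i.+1 => n ni; rewrite Psi_derive.
have K' m : 0 < 'D_1 (iter m k) x by have [] := iter_smooth_derive_gt0 m sk k'_gt0.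
have J' m : 0 < 'D_1 (iter m j) x by have [] := iter_smooth_derive_gt0 m sj j'_gt0.
have s' y : 0 <= 'D_1 (step l) y by exact: step_derive_ge0.
rewrite (bigD1 (Ordinal ni)) //=; apply: ltr_wpDr.
  by apply: sumr_ge0 => m _; rewrite addr_ge0// mulr_ge0// ltW// J'.
have [iP'|iP'] := iP.
  by rewrite ltr_wpDl// ?mulr_ge0 ?s' ?(ltW (J' i.+1))// mulr_gt0// step_derive_gt0.
by rewrite ltr_pwDl// ?mulr_ge0 ?s' ?(ltW (K' i))// mulr_gt0 ?J'// step_derive_gt0.
Qed.

(** The Abel function is the sum over i >= 0 of
      step (k^-(i+1) x) + (step (k^i x) - 1),
    which is locally a finite sum.  Applying k amounts to moving the term i = 0
    of the second family to the first one, which increases the sum by 1. *)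
Lemma abel_function : exists psi : R -> R, [/\ smooth_on setT psi,
  forall x, 0 < 'D_1 psi x, forall x, psi (k x) = psi x + 1 &
  forall y, exists x, psi x = y].
Proof.
have /choice[N NP] := Psi_stable.
pose psi x := Psi (N x) x.
have psiE n x y : (N x <= n)%N -> `|y - x| <= 1 -> psi y = Psi n y.
  move=> xn xy; pose m := maxn n (N y).
  rewrite /psi -(NP y m) ?leq_maxr ?subrr ?normr0//.
  by rewrite (NP x m) ?(NP x n)// (leq_trans xn) ?leq_maxl.
have psinear n (x : R) : (N x <= n)%N -> \forall y \near x, Psi n y = psi y.
  move=> xn; apply/near_distP; exists 1 => // y /ltW xy; exact/esym/(psiE n x).
have psi_s : smooth_on setT psi.
  move=> m; apply: Ck_on_local => x _; exists [set x] => //.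
  apply: Ck_on_near_eq (Ck_on_sub (@subsetT _ _) (Psi_smooth (N x) m)).
  by move=> _ ->; exact: psinear.
have psik x : psi (k x) = psi x + 1.
  have [n1 n1P] := iter_unbounded x l; have [n2 n2P] := iter_inverse_unbounded x 0.
  (* One truncation that is valid at both x and k x. *)
  have [n [nx nkx nn1 nn2]] :
      exists n, [/\ (N x <= n)%N, (N (k x) <= n)%N, (n1 <= n)%N & (n2 <= n)%N].
    by exists (N x + N (k x) + n1 + n2)%N; split; lia.
  have self y : `|y - y| <= 1 by rewrite subrr normr0.
  have := Psi_equivariance n x.
  rewrite (step_ge l_gt0 (n1P _ nn1)) step_le0 ?n2P//.
  rewrite (psiE n x x) ?self// (psiE n (k x) (k x)) ?self//; lra.
have psiiter n x : psi (iter n k x) = psi x + n%:R.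
  elim: n => [|n IH]; first by rewrite addr0.
  by rewrite iterS psik IH -natr1 addrA.
exists psi; split=> //.
- move=> x; have [n0 n0P] := Psi_derive_gt0 x; pose n := maxn n0 (N x).
  have nx : (N x <= n)%N by exact: leq_maxr.
  by rewrite -(@near_eq_derive _ R R _ _ x 1 (psinear n x nx)) n0P// leq_maxl.
- move=> y; pose n := (Num.truncn `|y - psi 0|).+1.
  have yn : `|y - psi 0| < n%:R by rewrite truncnS_gt.
  move: yn; rewrite ltr_distl => /andP[ny yn].
  have jk0 : psi (iter n j 0) = psi 0 - n%:R.
    apply/eqP; rewrite eq_sym subr_eq -psiiter; apply/eqP; congr psi.
    exact/esym/iter_inverseKV.
  have [|||x _] := @IVT_le _ psi (iter n j 0) (iter n k 0) y; last by exists x.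
  (* The orbit of 0 provides values of psi below and above y. *)
  + have K0 := iter_ge n 0; apply: le_trans K0.
    by rewrite -[leRHS](iter_inverseK n) (le_mono (@J_lt n)) iter_ge.
  + by move=> z _; exact: smoothR_continuous.
  + by rewrite jk0 psiiter (ltW ny)/= ltW.
Qed.

End abel_function.

(** * Consequences of the injectivity of circle phases *)

Section periodic_maps.
Context {R : realType}.
Variables (N : manifold R) (u : real_line R -> N).
Hypothesis su : smooth u.

(** psi is a lift of a phase function onto the circle; its fibres are those of
    psi modulo the integers, so u descends. *)
Lemma lift_factorization (psi : R -> R) : smooth_on setT psi ->
  (forall x, 0 < 'D_1 psi x) -> (forall y, exists x, psi x = y) ->
  (forall x y, psi x - psi y \is a Num.int -> u x = u y) ->
  exists U : circle R -> N,
    qp_factorization u (@circle_pi R \o psi : real_line R -> circle R) U.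
Proof.
move=> spsi psi'0 psi_surj upsi.
have sub : submersion (@circle_pi R \o psi : real_line R -> circle R).
  by apply: circle_lift_submersion => // x; rewrite gt_eqF.
have surj p : exists x, (@circle_pi R \o psi : real_line R -> circle R) x = p.
  have [t <-] := circle_pi_surj p; have [x <-] := psi_surj t; by exists x.
have [|U [sU UE]] := smooth_descent sub (erefl : man_dim (circle R) = 1%N) su surj.
  by move=> x y /circle_piP; exact: upsi.
by exists U; split.
Qed.

Variable T : R.
Hypothesis T_gt0 : 0 < T.
Hypothesis uT : forall x : R, u (x + T) = u x.
Hypothesis phase_inj : forall (phi : real_line R -> circle R) (U : circle R -> N),
  qp_factorization u phi U ->
  forall a x y : R, a <= x < a + T -> a <= y < a + T -> phi x = phi y -> x = y.

(** The circle R/k is the phase space of a factorization of u whose phase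
    function takes the same value at x and k x. *)
Lemma invariant_map_ge_shift (k : R -> R) (C : R) : smooth_on setT k ->
  (forall x, 0 < 'D_1 k x) -> (forall x, x < k x) -> (forall x, k x <= x + C) ->
  (forall x, u (k x) = u x) -> forall x, x + T <= k x.
Proof.
move=> sk k'0 k_gt k_le uk x; rewrite leNgt; apply/negP => kxT.
have [j [sj kK jK j'0]] := smooth_inverse_ex sk k'0 k_gt k_le.
have [psi [spsi psi'0 psik psi_surj]] := abel_function sk sj k'0 j'0 kK jK k_gt.
have psi_lt := smoothR_derive_gt0_lt spsi psi'0.
have psi_inj : injective psi by apply: inc_inj; exact: le_mono.
have psiiter n y : psi (iter n k y) = psi y + n%:R.
  by elim: n => [|n IH]; rewrite ?addr0// iterS psik IH -natr1 addrA.
have uiter n y : u (iter n k y) = u y by elim: n => // n; rewrite iterS uk.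
have upsi y z : psi y - psi z \is a Num.int -> u y = u z.
  move=> /intrP[[n|n] E].
    have -> : y = iter n k z by apply: psi_inj; rewrite psiiter -[n%:R]/((n%:Z)%:~R) -E; lra.
    exact: uiter.
  have -> : z = iter n.+1 k y.
    apply: psi_inj; rewrite psiiter; move: E; rewrite NegzE mulrNz -pmulrn; lra.
  by rewrite uiter.
have [U UP] := lift_factorization spsi psi'0 psi_surj upsi.
(* x and k x both lie in [x, x + T[ and have the same phase. *)
have : x = k x.
  apply: (phase_inj UP (a := x)); rewrite ?lexx ?ltrDl ?T_gt0 ?(ltW (k_gt x)) ?kxT//=.
  by apply/circle_piP; rewrite psik opprD addrA subrr sub0r rpredN rpred1.
by move=> E; have := k_gt x; rewrite -E ltxx.
Qed.

(** If u is constant on ]p, q[, then the translation by T can be slowed down by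
    a small hump on ]p, q[ and still preserve u, against
    invariant_map_ge_shift. *)
Lemma locally_nonconstant (p q : R) : p < q ->
  ~ (forall x y : R, p < x < q -> p < y < q -> u x = u y).
Proof.
move=> pq uc; pose e : R := Num.min (4^-1) (T / 2).
(* Since the hump has values in [0, 1] and slope at most 2, the bound 1/4 keeps
   k increasing, and the bound T/2 keeps k x above x. *)
have e0 : 0 < e by rewrite lt_min; apply/andP; split; [|rewrite divr_gt0].
have e4 : e <= 4^-1 by rewrite ge_min lexx.
have eT : e <= T / 2 by rewrite ge_min lexx orbT.
pose k : R -> R := (fun x => 1 * x + T) + cst (- e) * hump p q.
have kE x : k x = x + T - e * hump p q x by rewrite /k !fctE mul1r mulNr.
have sk : smooth_on setT k.
  exact: smoothR_add (smoothR_affine 1 T) (smoothR_mul (smoothR_cst _) (hump_smooth p q)).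
have eh x : 0 <= e * hump p q x <= e.
  by rewrite mulr_ge0 ?hump_ge0 ?(ltW e0)//= ler_piMr ?hump_le1// ltW.
have k'0 x : 0 < 'D_1 k x.
  have d := is_deriveD (is_derive_affine 1 T x)
    (is_deriveZ (- e) (smoothR_is_derive x (hump_smooth p q))).
  have -> : 'D_1 k x = 1 + - e * 'D_1 (hump p q) x by rewrite -[RHS](derive_val (is_derive := d)).
  have : `|e * 'D_1 (hump p q) x| <= 4^-1 * 2.
    by rewrite normrM ler_pM// ?(gtr0_norm e0) ?hump_derive_le.
  rewrite ler_norml mulNr => /andP[_]; lra.
have k_lt := smoothR_derive_gt0_lt sk k'0.
have k_gt x : x < k x by have /andP[_] := eh x; rewrite kE; lra.
have k_le x : k x <= x + T by have /andP[h _] := eh x; rewrite kE; lra.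
have uk x : u (k x) = u x.
  have [xpq|xpq] := boolP (p < x < q); last by rewrite kE hump_eq0// mulr0 subr0 uT.
  (* k - T maps ]p, q[ to itself, being increasing and fixing p. *)
  rewrite -[k x](subrK T) uT; apply: uc => //; move: (xpq) => /andP[px xq].
  have := k_le x; have := k_lt _ _ px; rewrite (kE p) hump_eq0 ?ltxx//.
  by move=> ? ?; apply/andP; split; lra.
pose m := (p + q) / 2.
have := invariant_map_ge_shift sk k'0 k_gt k_le uk m.
have : 0 < e * hump p q m.
  by rewrite mulr_gt0// hump_gt0//; apply/andP; split; rewrite /m; lra.
rewrite kE; lra.
Qed.

End periodic_maps.

(** * The fibre relation of a submersion of the line *)

Section pair_neighbourhoods.
Context {R : realType}.

(** The product neighbourhood filter with an explicit common radius, so that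
    linear arithmetic applies to its members. *)
Definition near_both (x y : R) (Q : R -> R -> Prop) :=
  exists2 e, 0 < e & forall s t, `|s - x| < e -> `|t - y| < e -> Q s t.

Lemma near_bothP (x y : R) (Q : R -> R -> Prop) :
  (\forall s \near x & t \near y, Q s t) -> near_both x y Q.
Proof.
move=> [[A B] /= [/near_distP[e e0 eA] /near_distP[e' e'0 eB]] AB].
exists (Num.min e e'); first by rewrite lt_min e0.
by move=> s t; rewrite !lt_min => /andP[/eA As _] /andP[_ /eB Bt]; exact: (AB (s, t)).
Qed.

(** The tube lemma, from the compactness of [a, b]. *)
Lemma near_both_segment (x a b : R) (Q : R -> R -> Prop) :
  (forall y, a <= y <= b -> near_both x y Q) ->
  exists2 e, 0 < e & forall s t, `|s - x| < e -> a <= t <= b -> Q s t.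
Proof.
move=> abQ.
have /compact_near_coveringP cab := @segment_compact R a b.
have [] := cab R (nbhs x) (fun s t => Q s t) _ _.
  move=> y; rewrite /= in_itv /= => /abQ[e e0 eQ].
  exists ([set t | `|t - y| < e], [set s | `|s - x| < e]).
    by split; apply/near_distP; exists e.
  by move=> [t s] [] /= ty sx; exact: eQ.
move=> e /= e0 eQ; exists e => // s t sx tab.
by apply: (eQ s) => //=; rewrite ?in_itv// /ball/= distrC.
Qed.

End pair_neighbourhoods.

(** M is Hausdorff. *)
Lemma near_both_separation {R : realType} (M : manifold R) (f : real_line R -> M) (x y : R) :
  continuous f -> f x <> f y -> near_both x y (fun s t => f s <> f t).
Proof.
move=> fc /eqP fxy.
have := @man_hausdorff R M; rewrite open_hausdorff => /(_ _ _ fxy).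
move=> [[A B] /= [/set_mem Ax /set_mem By] [oA oB AB]].
apply: near_bothP; exists (f @^-1` A, f @^-1` B).
  by split; apply: fc; exact: open_nbhs_nbhs.
move=> [s t] [/= As Bt] fst; have : (A `&` B) (f s) by split=> //; rewrite fst.
by move/eqP: AB => ->.
Qed.

Section branches.
Context {R : realType}.
Variables (M : manifold R) (P : real_line R -> M).
Hypothesis subP : submersion P.
Hypothesis dim1 : man_dim M = 1%N.

Let i0 : 'I_(man_dim M) := cast_ord (esym dim1) ord0.

Lemma fibre_closed (x y : R) : P x <> P y -> near_both x y (fun s t => P s <> P t).
Proof. by have [[Pc _] _] := subP; exact: near_both_separation. Qed.

(** Near (x, y) the relation P s = P t is the graph of h, the composition of P
    read in a chart with the local section of P through y. *)
Lemma branch_ex (x y : R) : P x = P y -> exists (A : set R) (h : R -> R),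
  [/\ open A, A x & smooth_on A h] /\
  [/\ forall s, A s -> 'D_1 h s != 0, forall s, A s -> P (h s) = P s, h x = y &
      \forall t \near y, forall s, P s = P t -> t = h s].
Proof.
move=> Pxy; have [[Pc _] _] := subP.
have [d ad dy] := man_cover (P y).
have [B [s [oB sB rsB invB ny]]] := local_section subP dim1 ad dy.
pose r := chart_reading P d i0; pose D : set R := P @^-1` chart_dom d.
have oD : open D by exact: open_preimage_chart.
have sr : smooth_on D r := chart_reading_smooth i0 subP ad.
have [_ Bry sry] := nbhs_singleton ny.
have rE t t' : P t = P t' -> r t = r t' by rewrite /r /chart_reading /= => ->.
have oA : open (D `&` r @^-1` B) by apply: open_preimage_within => // b; exact: (sr 0%N).
exists (D `&` r @^-1` B), (s \o r).
have Ph t : (D `&` r @^-1` B) t -> P (s (r t)) = P t.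
  move=> [Dt Bt]; rewrite -invB// /r /chart_reading /=.
  by rewrite (row_coordK dim1) chart_funK.
have sh : smooth_on (D `&` r @^-1` B) (s \o r).
  move=> k; apply: (Ck_on_comp oA oB (fun t (h : (D `&` r @^-1` B) t) => h.2)); last exact: sB.
  exact: Ck_on_sub (@subIsetl _ D _) (sr k).
split; split=> //.
- split; first by rewrite /D /= Pxy.
  by rewrite /= (rE _ _ Pxy).
- move=> t At; have [Dt Bt] := At.
  (* Differentiate r o h = r, where r is P read in the chart. *)
  have r'0 : 'D_1 r t != 0 by exact: chart_reading_derive_neq0.
  have [/(_ t At) dh _] := sh 1%N.
  have Dst : D (s (r t)) by rewrite /D /= Ph.
  have [/(_ _ Dst) dr _] := sr 1%N.
  have dh' : is_derive t 1 (s \o r) ('D_1 (s \o r) t) by exact/derivableP/diff_derivable.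
  have dr' : is_derive ((s \o r) t) 1 r ('D_1 r (s (r t))) by exact/derivableP/diff_derivable.
  have [_ E] := is_derive1_comp dr' dh'.
  have : 'D_1 (r \o (s \o r)) t = 'D_1 r t.
    apply: near_eq_derive; apply: filterS (open_nbhs_nbhs (conj oA At)) => z Az.
    exact/rE/Ph.
  by rewrite E => E'; move: r'0; rewrite -E' mulf_eq0 negb_or => /andP[].
- by rewrite /= (rE _ _ Pxy).
- apply: filterS ny => t [dt Bt st] z Pzt.
  by rewrite /= (rE _ _ Pzt).
Qed.

Lemma locally_injective (x : R) : near_both x x (fun s t => P s = P t -> s = t).
Proof.
have [A [h [[oA Ax sh] [h' Ph hx /near_distP[e e0 eh]]]]] := branch_ex (erefl (P x)).
exists e => // s t sx tx Pst.
by rewrite [LHS](eh s sx t (esym Pst)) -(eh t tx t erefl).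
Qed.

(** With r being < or >, the graph P s = P t is increasing, respectively
    decreasing, near (x, y).  Stating it on the relation instead of on a branch
    h makes it visibly stable under a small move of (x, y). *)
Definition sheet_order (r : rel R) (x y : R) := exists2 e, 0 < e &
  forall s s' t t', `|s - x| < e -> `|s' - x| < e -> `|t - y| < e -> `|t' - y| < e ->
  P s = P t -> P s' = P t' -> s < s' -> r t t'.

Lemma sheet_order_open r x y : sheet_order r x y -> near_both x y (sheet_order r).
Proof.
move=> [e e0 er]; exists (e / 2); first by rewrite divr_gt0.
move=> s t sx ty; exists (e / 2); first by rewrite divr_gt0.
move=> a a' b b' as_ a's bt b't; apply: er;
  [move: as_ sx|move: a's sx|move: bt ty|move: b't ty];
  rewrite !ltr_distl; lra.
Qed.

Lemma sheet_order_dichotomy (x y : R) : P x = P y ->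
  sheet_order <%R x y \/ sheet_order >%R x y.
Proof.
move=> Pxy.
have [A [h [[oA Ax sh] [h' Ph hx /near_distP[e0 e00 eh]]]]] := branch_ex Pxy.
have [dh /(_ 1) h'c] := sh 1%N.
have nA := open_nbhs_nbhs (conj oA Ax).
have := h' x Ax; rewrite neq_lt => /orP[h'x|h'x].
  have /near_distP[e1 e10 e1h] : \forall s \near x, A s /\ 'D_1 h s < 0.
    by apply: filterI nA _; exact: (cvgr_lt _ (h'c x Ax)) h'x.
  right; exists (Num.min e0 e1); first by rewrite lt_min e00.
  move=> s s' t t'; rewrite !lt_min => /andP[_ sx] /andP[_ s'x] /andP[ty _] /andP[t'y _].
  move=> Pst Ps't' ss'; rewrite (eh t ty s Pst) (eh t' t'y s' Ps't').
  have ssA z : s <= z <= s' -> A z /\ 'D_1 h z < 0.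
    by move=> /andP[sz zs']; apply: e1h; move: sx s'x; rewrite !ltr_distl; lra.
  have : (- h) s < (- h) s'.
    apply: derive_gt0_lt => // z /ssA[Az hz]; first exact/differentiableN/dh.
    by rewrite deriveN ?oppr_gt0//; exact/diff_derivable/dh.
  by rewrite ltrN2.
have /near_distP[e1 e10 e1h] : \forall s \near x, A s /\ 0 < 'D_1 h s.
  by apply: filterI nA _; exact: (cvgr_gt _ (h'c x Ax)) h'x.
left; exists (Num.min e0 e1); first by rewrite lt_min e00.
move=> s s' t t'; rewrite !lt_min => /andP[_ sx] /andP[_ s'x] /andP[ty _] /andP[t'y _].
move=> Pst Ps't' ss'; rewrite (eh t ty s Pst) (eh t' t'y s' Ps't').
have ssA z : s <= z <= s' -> A z /\ 0 < 'D_1 h z.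
  by move=> /andP[sz zs']; apply: e1h; move: sx s'x; rewrite !ltr_distl; lra.
by apply: derive_gt0_lt => // z /ssA[Az hz] //; exact: dh.
Qed.

Lemma branch_near (x y e : R) : P x = P y -> 0 < e -> exists2 e', 0 < e' &
  forall s, `|s - x| < e' -> exists2 t, `|t - y| < e & P s = P t.
Proof.
move=> Pxy e0; have [A [h [[oA Ax sh] [h' Ph hx _]]]] := branch_ex Pxy.
have nA := open_nbhs_nbhs (conj oA Ax).
have hc : {for x, continuous h} by exact: (sh 0%N).
have /near_distP[e' e'0 eh] : \forall s \near x, A s /\ `|h s - y| < e.
  apply: filterI nA _; rewrite -hx.
  have he : \forall z \near h x, `|z - h x| < e by apply/near_distP; exists e.
  exact: (hc _ he).
by exists e' => // s /eh[As hs]; exists (h s) => //; rewrite Ph.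
Qed.

(** There are two distinct points on the graph near (x, y), and they cannot be in
    increasing and in decreasing position at once. *)
Lemma sheet_order_excl (x y : R) : P x = P y ->
  sheet_order <%R x y -> sheet_order >%R x y -> False.
Proof.
move=> Pxy [e e0 ei] [e1 e10 ed].
have m0 : 0 < Num.min e e1 by rewrite lt_min e0.
have [e' e'0 ex] := branch_near Pxy m0.
pose m := Num.min e' (Num.min e e1) / 2.
have mm : 0 < Num.min e' (Num.min e e1) by rewrite lt_min e'0.
have [mp me' me me1] : [/\ 0 < m, m < e', m < e & m < e1].
  have : m < Num.min e' (Num.min e e1) by rewrite /m; lra.
  by rewrite !lt_min => /and3P[? ? ?]; split=> //; rewrite divr_gt0.
have [|t] := ex (x + m); first by rewrite addrC addKr gtr0_norm.
rewrite lt_min => /andP[te te1] Pt.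
have xx (a : R) : 0 < a -> `|x - x| < a by rewrite subrr normr0.
have yy (a : R) : 0 < a -> `|y - y| < a by rewrite subrr normr0.
have mx a : m < a -> `|x + m - x| < a by rewrite addrC addKr gtr0_norm.
have xm : x < x + m by rewrite ltrDl.
have := ei _ _ _ _ (xx _ e0) (mx _ me) (yy _ e0) te Pxy Pt xm.
have := ed _ _ _ _ (xx _ e10) (mx _ me1) (yy _ e10) te1 Pxy Pt xm.
by move=> /= ty /(lt_trans ty); rewrite ltxx.
Qed.

(** The graph through (x, x) contains the diagonal. *)
Lemma sheet_decreasing_diag_false (x : R) : ~ sheet_order >%R x x.
Proof.
move=> [e e0 eo].
have hh : `|x + e / 2 - x| < e by rewrite addrC addKr gtr0_norm; lra.
have h0 : `|x - x| < e by rewrite subrr normr0.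
have := eo _ _ _ _ h0 hh h0 hh erefl erefl.
rewrite ltrDl divr_gt0// => /(_ isT) /=; lra.
Qed.

(** Follow the decreasing graph from (x, y), x < y, to the right: both
    coordinates get closer.  Let c be the supremum of the abscissas of the points
    (s, t) reached with s <= t <= y.  By compactness c is attained, at a point
    (c, t) where the graph is still decreasing.  If c = t, this contradicts
    sheet_decreasing_diag_false; if c < t, one can move further right. *)
Lemma sheet_decreasing_lt_false (x y : R) : x < y -> P x = P y -> ~ sheet_order >%R x y.
Proof.
move=> xy Pxy dxy.
pose F s t := [/\ s <= t <= y, P s = P t & sheet_order >%R s t].
pose X := [set s | exists t, F s t].
have Fxy : F x y by split=> //; rewrite ltW//= lexx.
have supX : has_sup X.
  split; first by exists x, y.
  by exists y => s [t [/andP[st ty] _ _]]; exact: le_trans ty.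
set c := sup X.
have [t [/andP[ct ty] Pct dct]] : exists t, F c t.
  apply: contrapT => /forallNP cN.
  (* If no such t existed, then F would hold at no s near c; the margin c - 1
     covers all candidates t >= s for s near c. *)
  have [|e e0 eQ] := @near_both_segment _ c (c - 1) y (fun s t => ~ F s t).
    move=> z /andP[_ zy]; have [Pcz|Pcz] := pselect (P c = P z); last first.
      have [e e0 eP] := fibre_closed Pcz; exists e => // s t sc tz [_ Pst _].
      exact: eP Pst.
    have [zc|cz] := ltP z c.
      exists ((c - z) / 2); first by rewrite divr_gt0// subr_gt0.
      move=> s t; rewrite !ltr_distl => /andP[sc _] /andP[_ tz] [/andP[st _] _ _].
      by move: st; rewrite leNgt => /negP; apply; lra.
    have icz : sheet_order <%R c z.
      have [//|dcz] := sheet_order_dichotomy Pcz.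
      by exfalso; apply: (cN z); split=> //; rewrite cz.
    have [e e0 eo] := sheet_order_open icz; exists e => // s t sc tz [_ Pst dst].
    exact: (sheet_order_excl Pst (eo _ _ sc tz) dst).
  have m0 : 0 < Num.min e 1 by rewrite lt_min e0 ltr01.
  have [s Xs sc] := sup_adherent m0 supX; have sc' : s <= c := sup_ubound supX.2 Xs.
  have [t Fst] := Xs; have [/andP[st ty] _ _] := Fst.
  have [me m1] : Num.min e 1 <= e /\ Num.min e 1 <= 1 by rewrite !ge_min !lexx orbT.
  apply: (eQ s t) Fst; first by rewrite ltr_distl -/c in sc *; lra.
  by apply/andP; split=> //; rewrite -/c in sc; lra.
move: ct; rewrite le_eqVlt => /orP[/eqP ct|ct].
  by rewrite -ct in dct; exact: sheet_decreasing_diag_false dct.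
have [e e0 eo] := dct; have [e1 e10 e1o] := sheet_order_open dct.
(* Moving right by a small a < g, the partner t' stays within g of t; as
   2 g <= t - c, the new point is still above the diagonal. *)
pose g := Num.min (t - c) (Num.min e e1) / 2.
have g0 : 0 < g by rewrite divr_gt0// !lt_min subr_gt0 ct e0 e10.
have [gtc ge ge1] : [/\ g <= (t - c) / 2, g <= e / 2 & g <= e1 / 2].
  by rewrite /g !ler_pM2r ?invr_gt0// !ge_min !lexx !orbT.
have [e2 e20 e2b] := branch_near Pct g0.
pose a := Num.min g e2 / 2.
have a0 : 0 < a by rewrite divr_gt0// lt_min g0.
have [ag ae2] : a <= g / 2 /\ a <= e2 / 2.
  by rewrite /a !ler_pM2r ?invr_gt0// !ge_min !lexx !orbT.
have na : `|c + a - c| = a by rewrite addrC addKr gtr0_norm.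
have [|t' t't Pt'] := e2b (c + a); first by rewrite na; lra.
have t'lt : t' < t.
  apply: (eo c (c + a) t t') => //; rewrite ?subrr ?normr0 ?na//; lra.
have : X (c + a).
  exists t'; split=> //.
    by move: t't; rewrite ltr_distl => /andP[? ?]; apply/andP; split; lra.
  by apply: e1o; rewrite ?na; lra.
by move=> /(sup_ubound supX.2); rewrite -/c gerDl leNgt a0.
Qed.

(** Exchanging x and y turns a decreasing graph into a decreasing one, so it is
    enough to exclude x < y and x = y. *)
Lemma sheet_increasing (x y : R) : P x = P y -> sheet_order <%R x y.
Proof.
move=> Pxy; have [xy|yx|exy] := ltgtP x y.
- by have [//|/(sheet_decreasing_lt_false xy Pxy)] := sheet_order_dichotomy Pxy.
- have [//|[e e0 ed]] := sheet_order_dichotomy Pxy; exfalso.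
  apply: (sheet_decreasing_lt_false yx (esym Pxy)).
  have [e1 e10 einj] := locally_injective y.
  exists (Num.min e e1); first by rewrite lt_min e0.
  move=> s s' t t'; rewrite !lt_min => /andP[sy sy1] /andP[s'y s'y1] /andP[tx _] /andP[t'x _].
  move=> Pst Pst' ss' /=; case: (ltgtP t' t) => // tt'.
    have := ed _ _ _ _ tx t'x sy s'y (esym Pst) (esym Pst') tt'.
    by move=> /(lt_trans ss'); rewrite ltxx.
  have Pss' : P s = P s' by rewrite Pst Pst' tt'.
  by move: ss'; rewrite (einj _ _ sy1 s'y1 Pss') ltxx.
- rewrite -exy; have [//|/sheet_decreasing_diag_false//] :=
    sheet_order_dichotomy (erefl (P x)).
Qed.

Lemma branch_derive_gt0 A h (x : R) : open A -> A x -> smooth_on A h ->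
  (forall s, A s -> 'D_1 h s != 0) -> (forall s, A s -> P (h s) = P s) ->
  0 < 'D_1 h x.
Proof.
move=> oA Ax sh h' Ph; have := h' x Ax; rewrite neq_lt => /orP[h'x|//]; exfalso.
have [e e0 eo] := sheet_increasing (esym (Ph x Ax)).
have [dh /(_ 1) h'c] := sh 1%N.
have nA := open_nbhs_nbhs (conj oA Ax).
have /near_distP[d d0 dP] : \forall s \near x, [/\ A s, 'D_1 h s < 0 & `|h s - h x| < e].
  have he : \forall z \near h x, `|z - h x| < e by apply/near_distP; exists e.
  by apply: filterS3 nA ((cvgr_lt _ (h'c x Ax)) _ h'x) (sh 0%N x Ax _ he).
pose a := Num.min d e / 2.
have a0 : 0 < a by rewrite divr_gt0// lt_min d0.
have [ad ae] : a <= d / 2 /\ a <= e / 2 by rewrite /a !ler_pM2r ?invr_gt0// !ge_min !lexx !orbT.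
have ssA z : x <= z <= x + a -> A z /\ 'D_1 h z < 0.
  move=> /andP[xz za]; have [|Az hz _] := dP z; last by split.
  by rewrite ltr_distl; lra.
have [|Axa _ hxa] := dP (x + a); first by rewrite ltr_distl; lra.
have lt1 : (- h) x < (- h) (x + a).
  apply: derive_gt0_lt => [|z /ssA[Az hz]|z /ssA[Az hz]]; first by rewrite ltrDl.
    exact/differentiableN/dh.
  by rewrite deriveN ?oppr_gt0//; exact/diff_derivable/dh.
have lt2 : h x < h (x + a).
  apply: (eo x (x + a)); rewrite ?subrr ?normr0 ?ltrDl ?Ph//.
  by rewrite ltr_distl; lra.
by move: lt1; rewrite ltrN2 => /(lt_trans lt2); rewrite ltxx.
Qed.

End branches.

(** * Rigidity of local symmetries *)

Section fixed_points.
Context {R : realType}.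
Variable (N : manifold R).

(** Let c be the last point of [x, s] with c <= k c.  On ]c, s] the map k moves
    points to the left without crossing c.  Hence the least r in [c, t] with
    v r = v t is c: otherwise k r would be a smaller one. *)
Lemma contraction_constant (v : real_line R -> N) (k : R -> R) (x s : R) :
  continuous v -> x < s -> (forall t, x <= t <= s -> {for t, continuous k}) ->
  (forall a b, x <= a -> a <= b -> b <= s -> k a <= k b) ->
  k x = x -> k s < s -> (forall t, x <= t <= s -> v (k t) = v t) ->
  exists2 c, x <= c < s & forall t, c < t <= s -> v t = v c.
Proof.
move=> vc xs kc kmono kx ks vk.
pose F := [set t | x <= t <= s /\ t <= k t].
have supF : has_sup F.
  split; first by exists x; rewrite /F /= lexx kx ltW.
  by exists s => t [/andP[]].
set c := sup F.
have xc : x <= c by apply: (sup_ubound supF.2); rewrite /F /= lexx kx ltW.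
have cs : c <= s by apply: ge_sup; [exact: supF.1|move=> t [/andP[]]].
have kgt t : c < t <= s -> k t < t.
  move=> /andP[ct ts]; rewrite ltNge; apply/negP => tk.
  have : F t by split=> //; rewrite ts andbT; apply: le_trans (ltW ct).
  by move=> /(sup_ubound supF.2); rewrite -/c leNgt ct.
have kcc : c <= k c.
  rewrite leNgt; apply/negP => ckc.
  have cc : x <= c <= s by rewrite xc.
  have id_c : {for c, continuous (fun t : R => t - k t)}.
    by apply: continuousB; [exact: cvg_id|exact: kc].
  have /near_distP[e e0 eP] : \forall t \near c, 0 < t - k t.
    by apply: (cvgr_gt _ id_c); rewrite subr_gt0.
  have [t Ft ct] := sup_adherent e0 supF; have tc : t <= c := sup_ubound supF.2 Ft.
  have : 0 < t - k t by apply: eP; rewrite -/c in ct; rewrite ltr_distl; lra.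
  by have [_] := Ft; rewrite subr_gt0 => /le_lt_trans h /h; rewrite ltxx.
have cs' : c < s.
  by rewrite lt_neqAle cs andbT; apply/eqP => E; move: kcc; rewrite E leNgt ks.
exists c; first by rewrite xc.
move=> t /andP[ct ts].
pose V := [set r | c <= r <= t /\ v r = v t].
have infV : has_inf V.
  split; first by exists t; rewrite /V /= lexx (ltW ct).
  by exists c => r [/andP[]].
set r0 := inf V.
have cr0 : c <= r0 by apply: lb_le_inf; [exact: infV.1|move=> r [/andP[]]].
have r0t : r0 <= t by apply: (ge_inf infV.2); rewrite /V /= lexx (ltW ct).
have vr0 : v r0 = v t.
  apply: contrapT => /(near_both_separation vc)[e e0 eP].
  have [r Vr rr0] := inf_adherent e0 infV; have r0r : r0 <= r := ge_inf infV.2 Vr.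
  have [_] := Vr; apply: eP; last by rewrite subrr normr0.
  by rewrite -/r0 in rr0; rewrite ltr_distl; lra.
move: cr0; rewrite le_eqVlt => /orP[/eqP ->//|cr0].
have kr0 : k r0 < r0 by apply: kgt; rewrite cr0; exact: le_trans ts.
have : V (k r0).
  split; last by rewrite vk// (le_trans xc (ltW cr0)) (le_trans r0t ts).
  rewrite (le_trans (ltW kr0) r0t) andbT (le_trans kcc)//.
  by apply: kmono => //; [exact: ltW|exact: le_trans ts].
by move=> /(ge_inf infV.2); rewrite -/r0 leNgt kr0.
Qed.

(** The mirror image of contraction_constant under t |-> - t. *)
Lemma expansion_constant (v : real_line R -> N) (k : R -> R) (x s : R) :
  continuous v -> s < x -> (forall t, s <= t <= x -> {for t, continuous k}) ->
  (forall a b, s <= a -> a <= b -> b <= x -> k a <= k b) ->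
  k x = x -> s < k s -> (forall t, s <= t <= x -> v (k t) = v t) ->
  exists2 c, s < c <= x & forall t, s <= t < c -> v t = v c.
Proof.
move=> vc sx kc kmono kx ks vk.
pose v' : real_line R -> N := v \o (-%R : R -> R).
pose k' : R -> R := fun t => - k (- t).
have nc : continuous (-%R : R -> R) by move=> r; exact: opp_continuous.
have flip t : - x <= t <= - s -> s <= - t <= x by move=> /andP[? ?]; apply/andP; split; lra.
have [|||a b xa ab bs|||t /flip ht|c /andP[xc cs] vcst] :=
    @contraction_constant v' k' (- x) (- s).
- move=> t; apply: continuous_comp; last exact: vc.
  exact: (nc t).
- by rewrite ltrN2.
- move=> t /flip ht; apply: continuousN.
  by apply: continuous_comp; [exact: nc|exact: kc].
- by rewrite /k' lerN2; apply: kmono; lra.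
- by rewrite /k' opprK kx.
- by rewrite /k' opprK ltrN2.
- by rewrite /v' /k' /= opprK vk.
- exists (- c); first by apply/andP; split; lra.
  move=> t /andP[st tc]; rewrite -[LHS]/(v t) -[t]opprK.
  by apply: (vcst (- t)); apply/andP; split; lra.
Qed.

End fixed_points.

Section rigidity.
Context {R : realType}.
Variables (N : manifold R) (u : real_line R -> N) (T : R).
Hypothesis uc : continuous u.
Hypothesis T_gt0 : 0 < T.
Hypothesis uT : forall x : R, u (x + T) = u x.
Hypothesis u_nonconst : forall p q : R, p < q ->
  ~ (forall x y : R, p < x < q -> p < y < q -> u x = u y).
Variables (M : manifold R) (P : real_line R -> M).
Hypothesis subP : submersion P.
Hypothesis dim1 : man_dim M = 1%N.
Hypothesis uP : forall x y, P x = P y -> u x = u y.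

Lemma periodic_int (n : int) (x : R) : u (x + n%:~R * T) = u x.
Proof.
have unat m y : u (y + m%:R * T) = u y.
  elim: m y => [|m IH] y; first by rewrite mul0r addr0.
  by rewrite -natr1 mulrDl mul1r addrA uT IH.
case: n => n; first exact: unat.
by rewrite NegzE mulrNz mulNr -[in RHS](subrK (n.+1%:~R * T) x) -pmulrn unat.
Qed.

(** After a translation by n T the graph becomes that of an increasing map k
    which fixes x and preserves u.  If it moved a point s towards x, u would be
    constant on an interval. *)
Lemma translation_sheet_bound (x z : R) (n : int) : z = x + n%:~R * T -> P x = P z ->
  near_both x z (fun s t => P s = P t ->
    (x < s -> s + (z - x) <= t) /\ (s < x -> t <= s + (z - x))).
Proof.
move=> zE Pxz.
have [A [h [[oA Ax sh] [h' Ph hx /near_distP[d d0 dh]]]]] := branch_ex subP dim1 Pxz.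
have [e e0 eo] := sheet_increasing subP dim1 Pxz.
have hc s : A s -> {for s, continuous h} := sh 0%N s.
have /near_distP[f f0 fP] : \forall s \near x, A s /\ `|h s - z| < e.
  have he : \forall y \near h x, `|y - z| < e by rewrite hx; apply/near_distP; exists e.
  exact: filterI (open_nbhs_nbhs (conj oA Ax)) (hc x Ax _ he).
pose k s := h s - n%:~R * T.
have kx : k x = x by rewrite /k hx zE addrK.
have kc s : A s -> {for s, continuous k}.
  by move=> As; apply: continuousB; [exact: hc|exact: cvg_cst].
have uk s : A s -> u (k s) = u s.
  by move=> As; rewrite -(periodic_int n) /k subrK; apply/uP/Ph.
exists (Num.min d (Num.min e f)); first by rewrite !lt_min d0 e0.
move=> s t; rewrite !lt_min => /and3P[_ se sf] /andP[td _] Pst.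
have tE := dh t td s Pst.
have near_s a : `|a - x| <= `|s - x| -> [/\ A a, `|a - x| < e & `|h a - z| < e].
  move=> ax; have [] := fP a (le_lt_trans ax sf).
  by move=> Aa hz; split=> //; exact: le_lt_trans se.
have hmono a b : `|a - x| <= `|s - x| -> `|b - x| <= `|s - x| -> a <= b -> k a <= k b.
  move=> /near_s[Aa ax ha] /near_s[Ab bx hb]; rewrite le_eqVlt => /orP[/eqP->//|ab].
  by rewrite lerD2r ltW//; apply: (eo a b); rewrite ?Ph.
split=> [xs|sx]; rewrite leNgt; apply/negP => st.
- have ins a : x <= a <= s -> `|a - x| <= `|s - x|.
    by move=> /andP[? ?]; rewrite !ger0_norm; lra.
  have [|||||||c /andP[xc cs] vc] := @contraction_constant _ _ u k x s => //.
  + by move=> a /ins/near_s[/kc].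
  + by move=> a b xa ab bs; apply: hmono => //; apply: ins; apply/andP; split; lra.
  + by rewrite /k -tE; rewrite zE in st; lra.
  + by move=> a /ins/near_s[/uk].
  apply: (u_nonconst cs) => a b /andP[ca as_] /andP[cb bs].
  by rewrite !vc ?ca ?cb ?ltW.
- have ins a : s <= a <= x -> `|a - x| <= `|s - x|.
    by move=> /andP[? ?]; rewrite !ler0_norm; lra.
  have [|||||||c /andP[sc cx] vc] := @expansion_constant _ _ u k x s => //.
  + by move=> a /ins/near_s[/kc].
  + by move=> a b xa ab bs; apply: hmono => //; apply: ins; apply/andP; split; lra.
  + by rewrite /k -tE; rewrite zE in st; lra.
  + by move=> a /ins/near_s[/uk].
  apply: (u_nonconst sc) => a b /andP[ca as_] /andP[cb bs].
  by rewrite !vc ?as_ ?bs ?ltW.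
Qed.

(** One inequality is translation_sheet_bound at (x, z), the other one is the
    same bound at (z, x), where the local map is the inverse one. *)
Lemma translation_sheet (x z : R) (n : int) : z = x + n%:~R * T -> P x = P z ->
  near_both x z (fun s t => P s = P t -> t - s = z - x).
Proof.
move=> zE Pxz; have xE : x = z + (- n)%:~R * T by rewrite zE mulrNz mulNr addrK.
have [e e0 eP] := translation_sheet_bound zE Pxz.
have [f f0 fP] := translation_sheet_bound xE (esym Pxz).
have [g g0 go] := sheet_increasing subP dim1 Pxz.
have [i i0 iP] := locally_injective subP dim1 z.
exists (Num.min (Num.min e f) (Num.min g i)); first by rewrite !lt_min e0 f0 g0.
have zz (a : R) : 0 < a -> `|z - z| < a by rewrite subrr normr0.
have xx (a : R) : 0 < a -> `|x - x| < a by rewrite subrr normr0.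
move=> s t; rewrite !lt_min => /andP[/andP[se sf] /andP[sg si]] /andP[/andP[te tf] /andP[tg ti]] Pst.
have [h1 h2] := eP s t se te Pst; have [h3 h4] := fP t s tf sf (esym Pst).
have [sx|xs|sx] := ltgtP s x.
- have tz : t < z := go _ _ _ _ sg (xx g g0) tg (zz g g0) Pst Pxz sx.
  by have := h2 sx; have := h4 tz; lra.
- have tz : z < t := go _ _ _ _ (xx g g0) sg (zz g g0) tg Pxz Pst xs.
  by have := h1 xs; have := h3 tz; lra.
- have -> : t = z by apply: iP => //; rewrite ?zz// -Pst sx.
  by rewrite sx.
Qed.

End rigidity.

(** * The least partner in a strip *)

Section global_map.
Context {R : realType}.
Variables (N : manifold R) (u : real_line R -> N) (T : R).
Hypothesis su : smooth u.
Hypothesis T_gt0 : 0 < T.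
Hypothesis uT : forall x : R, u (x + T) = u x.
Hypothesis phase_inj : forall (phi : real_line R -> circle R) (U : circle R -> N),
  qp_factorization u phi U ->
  forall a x y : R, a <= x < a + T -> a <= y < a + T -> phi x = phi y -> x = y.
Variables (M : manifold R) (P : real_line R -> M).
Hypothesis subP : submersion P.
Hypothesis dim1 : man_dim M = 1%N.
Hypothesis uP : forall x y, P x = P y -> u x = u y.

Let uc : continuous u := su.1.
Let u_nonconst := locally_nonconstant su T_gt0 uT phase_inj.
Let sheetT := translation_sheet uc uT u_nonconst subP dim1 uP.

Section strip.
Variable m : int.
Let c : R := m%:~R * T.

(** The partners z of x modulo TZ, normalized to the strip above the diagonal. *)
Definition strip_match (x z : R) : Prop := x < z < x + T /\ P x = P (z + c).

Lemma near_both_shift (x z d : R) (Q : R -> R -> Prop) :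
  near_both x (z + d) Q -> near_both x z (fun s t => Q s (t + d)).
Proof.
move=> [e e0 eQ]; exists e => // s t sx tz; apply: eQ => //.
by rewrite opprD addrACA subrr addr0.
Qed.

(** The only doubtful points are those of the boundary z = x or z = x + T of the
    strip.  There translation_sheet says that the points of the relation stay
    on the boundary line. *)
Lemma strip_match_closed (x z : R) : ~ strip_match x z ->
  near_both x z (fun s t => ~ strip_match s t).
Proof.
move=> nW; have [Pxz|Pxz] := pselect (P x = P (z + c)); last first.
  have [e e0 eP] := near_both_shift (fibre_closed subP Pxz); exists e => // s t sx tz [_].
  exact: eP.
have [zx|xz|zx] := ltgtP z x.
- exists ((x - z) / 2); first by rewrite divr_gt0// subr_gt0.
  move=> s t; rewrite !ltr_distl => /andP[sx _] /andP[_ tz] [/andP[st _] _].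
  suff : (0 : R) < 0 by rewrite ltxx.
    lra.
- have [zxT|xTz|zxT] := ltgtP z (x + T).
  + by exfalso; apply: nW; split=> //; rewrite xz.
  + exists ((z - (x + T)) / 2); first by rewrite divr_gt0// subr_gt0.
    move=> s t; rewrite !ltr_distl => /andP[_ sx] /andP[tz _] [/andP[_ st] _].
    suff : (0 : R) < 0 by rewrite ltxx.
    lra.
  (* On the line z = x + T the shift z + c - x is (m + 1) T. *)
  + have zE : z + c = x + (1 + m)%:~R * T by rewrite zxT /c intrD mulrDl mul1r addrA.
    have [e e0 eP] := near_both_shift (sheetT zE Pxz).
    exists e => // s t sx tz [/andP[_ st] Pst].
    have tsE := eP s t sx tz Pst.
    suff : (0 : R) < 0 by rewrite ltxx.
    lra.
- have zE : z + c = x + m%:~R * T by rewrite zx.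
  have [e e0 eP] := near_both_shift (sheetT zE Pxz).
  exists e => // s t sx tz [/andP[st _] Pst].
  have tsE := eP s t sx tz Pst.
    suff : (0 : R) < 0 by rewrite ltxx.
    lra.
Qed.

Lemma strip_branch (x z : R) : strip_match x z -> exists (A : set R) (h : R -> R),
  [/\ open A, A x, smooth_on A h, forall s, A s -> 0 < 'D_1 h s & h x = z] /\
  [/\ forall s, A s -> strip_match s (h s) &
      \forall t \near z, forall s, P s = P (t + c) -> t = h s].
Proof.
move=> [/andP[xz zxT] Pxz].
have [A [h [[oA Ax sh] [h' Ph hx nh]]]] := branch_ex subP dim1 Pxz.
have sk : smooth_on A (h + cst (- c)).
  by move=> k; apply: Ck_onD => //; exact: Ck_on_const.
have kc s : A s -> {for s, continuous (h + cst (- c))} := sk 0%N s.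
pose B := [set s | A s /\ s < (h + cst (- c)) s < s + T].
have oB : open B.
  rewrite openE => s [As /andP[h1 h2]].
  have c1 : {for s, continuous (fun t => (h + cst (- c)) t - t)}.
    by apply: continuousB; [exact: kc|exact: cvg_id].
  have n1 : \forall t \near s, 0 < (h + cst (- c)) t - t.
    by apply: (cvgr_gt _ c1); rewrite subr_gt0.
  have n2 : \forall t \near s, (h + cst (- c)) t - t < T.
    by apply: (cvgr_lt _ c1); lra.
  apply: filterS3 (open_nbhs_nbhs (conj oA As)) n1 n2 => t At t1 t2.
  by split=> //; apply/andP; split; lra.
exists B, (h + cst (- c)); split; split=> //.
- by split=> //; rewrite fctE hx addrK xz.
- by move=> k; apply: Ck_on_sub (sk k) => s [].
- move=> s [As _]; have [dh _] := sh 1%N.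
  have dhs : is_derive s (1 : R) h ('D_1 h s) by exact/derivableP/diff_derivable/dh.
  have d := is_deriveD dhs (is_derive_cst (- c) s (1 : R)).
  rewrite (derive_val (is_derive := d)) addr0.
  exact: (branch_derive_gt0 subP dim1 oA).
- by rewrite fctE hx addrK.
- by move=> s [As sb]; split=> //; rewrite fctE subrK Ph.
- have /near_distP[e e0 eP] := nh; apply/near_distP; exists e => // t tz s Pst.
  rewrite fctE; have := eP (t + c) _ s Pst.
  rewrite opprD addrACA subrr addr0 => /(_ tz) <-; by rewrite addrK.
Qed.

(** The set of x having a partner is open by strip_branch.  It is closed by
    strip_match_closed and compactness, as partners are bounded. *)
Lemma strip_match_total (x0 z0 : R) : strip_match x0 z0 -> forall x, exists z, strip_match x z.
Proof.
move=> W0; pose D := [set x | exists z, strip_match x z].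
suff : D = setT by move=> DT x; have : setT x by []; rewrite -DT.
have oD : open D.
  rewrite openE => x [z /strip_branch[A [h [[oA Ax _ _ _] [hW _]]]]].
  by apply: filterS (open_nbhs_nbhs (conj oA Ax)) => s As; exists (h s); exact: hW.
have oCD : open (~` D).
  rewrite openE => x /forallNP xD.
  (* The margin 1 covers the strips above all s near x. *)
  have [e e0 eW] := near_both_segment (fun y (_ : x - 1 <= y <= x + T + 1) =>
    strip_match_closed (xD y)).
  apply/near_distP; exists (Num.min e 1); first by rewrite lt_min e0 ltr01.
  move=> s; rewrite lt_min => /andP[sx sx1] [z /[dup] zW [/andP[sz zs] _]].
  apply: (eW s z) zW => //; move: sx1; rewrite ltr_distl; lra.
have cD : closed D by rewrite -[D]setCK; exact: open_closedC.
have /(_ D) := (connected_intervalP (@setT R)).2 (fun x y _ _ z _ => I).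
apply.
- by exists x0, z0.
- by exists D => //; rewrite setTI.
- by exists D => //; rewrite setTI.
Qed.

(** The least partner k x of x depends smoothly on x: it is locally a branch,
    because a smaller partner cannot appear near x without having a limit, which
    would be a smaller partner of x.  So k violates invariant_map_ge_shift. *)
Lemma strip_match_false (x0 z0 : R) : ~ strip_match x0 z0.
Proof.
move=> W0.
have /choice[k kP] : forall x, exists z, strip_match x z /\ forall t, strip_match x t -> z <= t.
  move=> x; have [z1 Wz1] := strip_match_total W0 x.
  have infW : has_inf [set z | strip_match x z].
    split; first by exists z1.
    by exists x => z [/andP[/ltW]].
  exists (inf [set z | strip_match x z]); split; last first.
    by move=> t Wt; exact: (ge_inf infW.2).
  apply: contrapT => /strip_match_closed[e e0 eW].
  have [z Wz zi] := inf_adherent e0 infW.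
  have iz := ge_inf infW.2 Wz.
  apply: (eW x z) Wz; rewrite ?subrr ?normr0// ltr_distl; lra.
have kW x : strip_match x (k x) by have [] := kP x.
have kmin x t : strip_match x t -> k x <= t by have [_] := kP x; apply.
have k_branch (x : R) : exists (A : set R) (h : R -> R),
    [/\ open A, A x, smooth_on A h & forall s, A s -> 0 < 'D_1 h s] /\
    \forall s \near x, h s = k s.
  have [A [h [[oA Ax sh h' hx] [hW hu]]]] := strip_branch (kW x).
  have hc : {for x, continuous h} by exact: (sh 0%N).
  exists A, h; split=> //.
  (* No partner t < h s exists for s near x.  At a partner y of x this is the
     uniqueness of the branch if y = k x, and the continuity of h if y > k x. *)
  have [y _|e e0 eP] := @near_both_segment _ x (x - 1) (k x + 1)
      (fun s t => ~ (strip_match s t /\ t < h s)).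
    have [Wy|/strip_match_closed[e e0 eW]] := pselect (strip_match x y); last first.
      by exists e => // s t sx ty [Wst _]; exact: eW Wst.
    have := kmin _ _ Wy; rewrite le_eqVlt => /orP[/eqP ky|ky].
      have /near_distP[e e0 eP] := hu; exists e => // s t _ ty [[_ Pst] ts].
      by rewrite -ky in ty; move: ts; rewrite -(eP t ty s Pst) ltxx.
    pose b := (y - k x) / 2; have b0 : 0 < b by rewrite divr_gt0// subr_gt0.
    have /near_distP[e e0 eP] : \forall s \near x, h s < k x + b.
      by apply: (cvgr_lt _ hc); rewrite hx ltrDl.
    exists (Num.min e b); first by rewrite lt_min e0.
    move=> s t; rewrite !lt_min => /andP[/eP hs _] /andP[_ ty] [_ ths].
    by move: ty; rewrite ltr_distl /b in hs *; lra.
  have nh1 : \forall s \near x, h s < k x + 1.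
    by apply: (cvgr_lt _ hc); rewrite hx ltrDl.
  have ne : \forall s \near x, `|s - x| < Num.min e 1.
    by apply/near_distP; exists (Num.min e 1) => //; rewrite lt_min e0 ltr01.
  (* h s is a partner of s, so k s <= h s; and k s < h s was excluded. *)
  apply: filterS3 (open_nbhs_nbhs (conj oA Ax)) nh1 ne => s As hs1.
  rewrite lt_min => /andP[se s1].
  have khs := kmin _ _ (hW s As); apply/eqP; rewrite eq_le khs andbT leNgt.
  apply/negP => klt; have [/andP[sk _] _] := kW s.
  apply: (eP s (k s)) => //; move: s1; rewrite ltr_distl; lra.
have sk : smooth_on setT k.
  move=> r; apply: Ck_on_local => x _; exists [set x] => //.
  have [A [h [[oA Ax sh _] hk]]] := k_branch x.
  apply: (@Ck_on_near_eq _ _ _ r [set x] h k) => [_ ->//|].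
  by apply: Ck_on_sub (sh r) => _ ->.
have k'0 (x : R) : 0 < 'D_1 k x.
  have [A [h [[oA Ax _ h'] hk]]] := k_branch x.
  by rewrite -(@near_eq_derive _ R R _ _ x 1 hk) h'.
have k_gt x : x < k x by have [/andP[]] := kW x.
have k_lt x : k x < x + T by have [/andP[]] := kW x.
have uk x : u (k x) = u x.
  by have [_ /uP ->] := kW x; rewrite periodic_int.
have := invariant_map_ge_shift su T_gt0 phase_inj sk k'0 k_gt (fun x => ltW (k_lt x)) uk 0.
by rewrite leNgt k_lt.
Qed.

End strip.

(** If x - y is not a multiple of T, the translate of y that lies in ]x, x + T[
    is a partner of x. *)
Lemma fibre_sub_period (x y : R) : P x = P y -> (x - y) / T \is a Num.int.
Proof.
move=> Pxy; pose m := Num.floor ((y - x) / T).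
have /andP[mle mlt] := floor_itv ((y - x) / T); rewrite -/m intrD in mle mlt.
rewrite ler_pdivlMr// in mle; rewrite ltr_pdivrMr// mulrDl mul1r in mlt.
move: mle; rewrite le_eqVlt => /orP[/eqP mE|mle].
  have -> : (x - y) / T = - m%:~R by rewrite -opprB -mE mulNr mulfK// gt_eqF.
  by rewrite rpredN intr_int.
exfalso; apply: (@strip_match_false m x (y - m%:~R * T)); split.
  by apply/andP; split; lra.
by rewrite subrK.
Qed.

End global_map.

(** * Universality *)

Section universality.
Context {R : realType}.
Variables (N : manifold R) (u : real_line R -> N) (T : R).
Hypothesis su : smooth u.
Hypothesis T_gt0 : 0 < T.
Hypothesis uT : forall x : R, u (x + T) = u x.
Variable phi : real_line R -> circle R.
Hypothesis phiE : forall x : R, phi x = circle_pi (x / T).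

Lemma period_factorization : exists U : circle R -> N, qp_factorization u phi U.
Proof.
have -> : phi = @circle_pi R \o (fun x => T^-1 * x + 0).
  by apply/funext => x; rewrite phiE /= addr0 mulrC.
have psi_surj (y : R) : exists x, T^-1 * x + 0 = y.
  by exists (T * y); rewrite addr0 mulKf// gt_eqF.
have psi'0 x : 0 < 'D_1 (fun x : R => T^-1 * x + 0) x.
  by rewrite (derive_val (is_derive := is_derive_affine T^-1 0 x)) invr_gt0.
apply: (lift_factorization su (smoothR_affine T^-1 0) psi'0 psi_surj).
move=> x y; rewrite !addr0 -mulrBr => /intrP[n E].
have -> : x = y + n%:~R * T.
  by rewrite -E mulrAC mulVf ?gt_eqF// mul1r addrC subrK.
exact: periodic_int.
Qed.

Hypothesis phase_inj : forall (phi' : real_line R -> circle R) (U' : circle R -> N),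
  qp_factorization u phi' U' ->
  forall a x y : R, a <= x < a + T -> a <= y < a + T -> phi' x = phi' y -> x = y.

(** In dimension 0 charts have singleton domains, so that the phase function,
    and hence u, is constant near 0. *)
Lemma phase_space_dim (C : manifold R) (phi' : real_line R -> C) (U' : C -> N) :
  qp_factorization u phi' U' -> man_dim C = 1%N.
Proof.
move=> [sub _ _ uE]; have := submersion_dim_le1 sub.
case: (posnP (man_dim C)) => [dim0 _|dim_gt0 dim_le1]; last first.
  by apply/eqP; rewrite eqn_leq dim_le1.
exfalso; have [[pc _] _] := sub; have [d ad d0] := man_cover (phi' 0).
have od : open (phi' @^-1` chart_dom d : set R) := open_preimage_chart pc.
have /near_distP[e e0 eP] := open_nbhs_nbhs (conj od d0).
have phi'c t : `|t - 0| < e -> phi' t = phi' 0.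
  move=> /eP dt; rewrite -(chart_funK dt) -(chart_funK d0); congr (chart_inv d _).
  by apply/rowP => -[i hi]; exfalso; move: hi; rewrite dim0.
apply: (@locally_nonconstant _ _ _ su _ T_gt0 uT phase_inj (- e) e); first by lra.
move=> x y ? ?; rewrite !uE !phi'c// subr0 ltr_norml//.
Qed.

Lemma period_factorization_universal (U : circle R -> N) :
  qp_factorization u phi U -> universal_qp_factorization u phi U.
Proof.
move=> UP; split=> // C phi' U' /[dup] UP' [sub' surj' _ uE'].
have [[sphi _] _ _ uE] := UP; have dim1 := phase_space_dim UP'.
have fib x y : phi' x = phi' y -> phi x = phi y.
  have uphi' s t : phi' s = phi' t -> u s = u t by rewrite !uE' => ->.
  move=> /(fibre_sub_period su T_gt0 uT phase_inj sub' dim1 uphi').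
  by rewrite !phiE => xyT; apply/circle_piP; rewrite -mulrBl.
(* U o c = U' since both agree after composition with the surjective phi'. *)
have [c [sc cE]] := smooth_descent sub' dim1 sphi surj' fib.
exists c; split=> // y; have [x <-] := surj' y.
by rewrite cE -uE uE'.
Qed.

End universality.

Unset Implicit Arguments.

Theorem theorem8 (R : realType) (N : manifold R) (T : R)
    (u : real_line R -> N) (phi : real_line R -> circle R) :
  0 < T ->
  smooth u ->
  (exists x y, u x <> u y) ->
  (forall x : R, u (x + T) = u x) ->
  (forall x : R, phi x = circle_pi (x / T)) ->
  quasiperiodic (circle R) u /\
  exists U : circle R -> N,
    qp_factorization u phi U /\
    ((forall (phi' : real_line R -> circle R) (U' : circle R -> N),
        qp_factorization u phi' U' ->
        forall a x y : R, a <= x < a + T -> a <= y < a + T ->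
          phi' x = phi' y -> x = y) ->
     universal_qp_factorization u phi U).
Proof.
move=> T_gt0 su _ uT phiE.
have [U UP] := period_factorization su T_gt0 uT phiE.
split; first by exists phi, U.
exists U; split=> // phase_inj.
exact: (period_factorization_universal su T_gt0 uT phiE phase_inj UP).
Qed.
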